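(* Let $d\ge 2$. For all $p\in[1,\infty]$ and all $u\in\mathbb{R}^d$ such that $\|u\|_p=1$, there exist constants $C_1=C_1(p,d,u)>0$ and $C_2=C_2(p,d,u)>0$ such that for all $\varepsilon>0$ small enough, $$C_1\,\varepsilon^{\kappa_p(u)}\le 1-\tilde\mu_{p,\varepsilon}(u)\le C_2\,\varepsilon^{\kappa_p(u)} .$$
   Context: Let $d\ge2$ and let $\|\cdot\|_p$, $p\in[1,\infty]$, be the usual $p$-norm on $\mathbb{R}^d$. Let $\Xi$ be a homogeneous Poisson point process on $\mathbb{R}^d$ with unit intensity with respect to Lebesgue measure. For $\varepsilon>0$ set $\Sigma_{p,\varepsilon}=\bigcup_{c\in\Xi}B_p(c,\varepsilon^{1/d}/2)$, where $B_p(c,r)$ is the closed ball of center $c$ and radius $r$ for $\|\cdot\|_p$. A polygonal path from $x$ to $y$ is a finite sequence $\pi=(x_0=x,x_1,\dots,x_n=y)$ of points, distinct except that possibly $x_0=x_n$, with $x_i\in\Xi$ for $1\le i\le n-1$ (the endpoints need not belong to $\Xi$). Its travel time is the $p$-length of $\pi$ outside $\Sigma_{p,\varepsilon}$: $\tilde T_{p,\varepsilon}(\pi)=\sum_{i=1}^n \ell_p([x_{i-1},x_i]\cap\Sigma_{p,\varepsilon}^c)$, where $\ell_p$ denotes $\|\cdot\|_p$-length (of a finite union of segments). Let $\tilde T_{p,\varepsilon}(x,y)=\inf_\pi\tilde T_{p,\varepsilon}(\pi)$, the infimum being over all polygonal paths from $x$ to $y$. For every $z\in\mathbb{R}^d$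 there is a deterministic constant $\tilde\mu_{p,\varepsilon}(z)\ge0$ (the time constant) such that $\lim_{s\to\infty}\tilde T_{p,\varepsilon}(0,sz)/s=\tilde\mu_{p,\varepsilon}(z)$ a.s. and in $L^1$. For $u\in\mathbb{R}^d$ let $d_1(u)=\mathrm{card}\{i:u_i\ne0\}$, $d_2(u)=d-d_1(u)$, $d_3(u)=\mathrm{card}\{i:|u_i|=\|u\|_\infty\}$, $d_4(u)=d-d_3(u)$, and for $\|u\|_p=1$ let $$\kappa_p(u)=\begin{cases}\dfrac1{d_1(u)}&\text{if }p=1,\\[2mm] \dfrac{1}{d-\frac{d_1(u)-1}{2}-\frac{d_2(u)}{p}}&\text{if }p\in(1,\infty),\\[2mm] \dfrac{1}{d_4(u)+1}&\text{if }p=\infty.\end{cases}$$ *)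

(* Defs.v *)
From HB Require Import structures.
From mathcomp Require Import all_boot all_order all_algebra.
From mathcomp Require Import all_classical all_reals all_analysis measurable_realfun.
Set Implicit Arguments.
Unset Strict Implicit.
Unset Printing Implicit Defensive.
Import Order.TTheory GRing.Theory Num.Theory.
Import numFieldNormedType.Exports.

Local Open Scope classical_set_scope.
Local Open Scope ring_scope.

(* Only the values p in [1, +oo] are meaningful. *)
Definition pnorm (R : realType) (d : nat) (p : \bar R) (x : 'rV[R]_d) : R :=
  match p with
  | r%:E => (\sum_(i < d) `|x 0 i| `^ r) `^ r^-1
  | +oo%E => \big[Num.max/0]_(i < d) `|x 0 i|
  | -oo%E => 0
  end.

Definition pball (R : realType) (d : nat) (p : \bar R) (c : 'rV[R]_d) (r : R)
    : set 'rV[R]_d :=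
  [set x | pnorm p (x - c) <= r].

Definition borel (R : realType) (d : nat) : set (set 'rV[R]_d) :=
  <<s @open 'rV[R]_d >>.

(* Lebesgue measure on R^d, as the d-fold product of the Lebesgue measure on R
   (each factor being integrated as in [product_measure1]). *)
Fixpoint lebesgue_rV (R : realType) (d : nat) : set 'rV[R]_d -> \bar R :=
  match d with
  | 0%N => fun A => (\1_A 0)%:E
  | d'.+1 => fun A =>
      (\int[lebesgue_measure]_(t in [set: R])
          lebesgue_rV [set v : 'rV[R]_d' | A (row_mx (const_mx t : 'rV_1) v)])%E
  end.

(* Taking some of the [A i] to be [setT] gives the product rule for
   subfamilies. *)
Definition mutually_independent (R : realType) (disp : measure_display)
    (T : measurableType disp) (P : probability T R) (n : nat)
    (X : 'I_n -> T -> \bar R) : Prop :=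
  forall A : 'I_n -> set (\bar R), (forall i, measurable (A i)) ->
    P (\bigcap_i (X i @^-1` A i)) = (\prod_(i < n) P (X i @^-1` A i))%E.

Definition point_count (R : realType) (d : nat) (T : Type)
    (Xi : T -> set 'rV[R]_d) (B : set 'rV[R]_d) (w : T) : \bar R :=
  counting (Xi w `&` B).

Record poisson_process (R : realType) (d : nat) (disp : measure_display)
    (T : measurableType disp) (P : probability T R)
    (Xi : T -> set 'rV[R]_d) : Prop := PoissonProcess {
  pp_locally_finite : forall w (K : set 'rV[R]_d), compact K ->
    finite_set (Xi w `&` K);
  pp_measurable : forall B, borel B ->
    measurable_fun [set: T] (point_count Xi B);
  (* The second argument of [poisson_prob] is a dummy. *)
  pp_poisson : forall B, borel B -> (lebesgue_rV B < +oo)%E -> forall k : nat,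
    P [set w | point_count Xi B w = k%:R%:E]
    = poisson_prob (fine (lebesgue_rV B)) k [set k];
  pp_independent : forall (n : nat) (B : 'I_n -> set 'rV[R]_d),
    (forall i, borel (B i)) -> trivIset [set: 'I_n] B ->
    mutually_independent P (fun i => point_count Xi (B i))
}.

Definition Sigma (R : realType) (d : nat) (p : \bar R) (eps : R)
    (X : set 'rV[R]_d) : set 'rV[R]_d :=
  \bigcup_(c in X) pball p c (eps `^ d%:R^-1 / 2).

(* The p-length of [x, y] `&` A: the affine parametrization of [x, y] by [0, 1]
   has constant p-speed pnorm p (y - x). *)
Definition plength (R : realType) (d : nat) (p : \bar R) (x y : 'rV[R]_d)
    (A : set 'rV[R]_d) : R :=
  pnorm p (y - x) *
  fine (lebesgue_measure [set t : R | 0 <= t <= 1 /\ A (x + t *: (y - x))]).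

(* A path x = x_0, x_1, ..., x_n = y, with n >= 1, is represented by the
   sequence s = [:: x_1; ...; x_(n-1)]; the two [uniq] conditions say that its
   points are distinct, except that x_0 = x_n is allowed. *)
Definition polygonal_path (R : realType) (d : nat) (X : set 'rV[R]_d)
    (x y : 'rV[R]_d) (s : seq 'rV[R]_d) : Prop :=
  [/\ uniq (x :: s), uniq (rcons s y) & {in s, forall z, X z}].

Definition path_time (R : realType) (d : nat) (p : \bar R) (eps : R)
    (X : set 'rV[R]_d) (x y : 'rV[R]_d) (s : seq 'rV[R]_d) : R :=
  \sum_(e <- zip (x :: s) (rcons s y)) plength p e.1 e.2 (~` Sigma p eps X).

Definition travel_time (R : realType) (d : nat) (p : \bar R) (eps : R)
    (X : set 'rV[R]_d) (x y : 'rV[R]_d) : R :=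
  inf [set path_time p eps X x y s | s in polygonal_path X x y].

(* [mu] is the almost sure and L^1 limit of the travel time from 0 to s z,
   divided by s, as the real number s tends to infinity. *)
Record is_time_constant (R : realType) (d : nat) (disp : measure_display)
    (T : measurableType disp) (P : probability T R) (Xi : T -> set 'rV[R]_d)
    (p : \bar R) (eps : R) (z : 'rV[R]_d) (mu : R) : Prop := IsTimeConstant {
  tc_ae : {ae P, forall w,
    travel_time p eps (Xi w) 0 (s *: z) / s @[s --> +oo] --> mu};
  tc_integrable : forall s : R, 0 < s ->
    P.-integrable [set: T] (fun w => (travel_time p eps (Xi w) 0 (s *: z))%:E);
  tc_L1 : (\int[P]_w (`|travel_time p eps (Xi w) 0 (s *: z) / s - mu|)%:E)%E
    @[s --> +oo] --> 0%E
}.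

Definition d1 (R : realType) (d : nat) (u : 'rV[R]_d) : nat :=
  #|[set i : 'I_d | u 0 i != 0]%SET|.
Definition d2 (R : realType) (d : nat) (u : 'rV[R]_d) : nat := (d - d1 u)%N.
Definition d3 (R : realType) (d : nat) (u : 'rV[R]_d) : nat :=
  #|[set i : 'I_d | `|u 0 i| == pnorm +oo%E u]%SET|.
Definition d4 (R : realType) (d : nat) (u : 'rV[R]_d) : nat := (d - d3 u)%N.

(* Only the values p in [1, +oo] are meaningful. *)
Definition kappa (R : realType) (d : nat) (p : \bar R) (u : 'rV[R]_d) : R :=
  match p with
  | r%:E => if r == 1 then ((d1 u)%:R)^-1
            else (d%:R - ((d1 u)%:R - 1) / 2 - (d2 u)%:R / r)^-1
  | +oo%E => ((d4 u)%:R + 1)^-1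
  | -oo%E => 0
  end.

(* Main.v *)
Require Import Defs.
From mathcomp Require Import all_boot all_order all_algebra.
From mathcomp Require Import all_classical all_reals all_analysis measurable_realfun.
From mathcomp Require Import zify ring lra.
Import Order.TTheory GRing.Theory Num.Theory.
Import numFieldNormedType.Exports.
Set Implicit Arguments.
Unset Strict Implicit.
Unset Printing Implicit Defensive.
Local Open Scope classical_set_scope.
Local Open Scope ring_scope.

(** Write delta = eps^(1/d) for the diameter of the balls and
x = eps^kappa = delta / L. The exponent kappa comes from one geometric fact.
Consider the vectors that advance by about L in the direction u and are longer
than this advance by at most delta. They fill a thin box along u, and L is the
length for which its volume is of order one. A path that heads for u therefore
finds about one useful Poisson point per length L. Each of them saves about
delta, so that 1 - mu is of order delta / L = eps^kappa.

The shape of the box is recorded by [adapted]. The form [linf f] is a norming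
functional of u: linear, below the norm, equal to 1 at u. In the coordinates
[skew], along u and across it, the box has width delta x^(-beta i) in direction
i, with beta i = 1 along u. The field [ad_low] is a linear lower bound of the
norm that charges for leaving the box, [ad_up] an upper bound inside it.
[exists_adapted] finds beta: it is 0 across a corner of the sphere, 1/2 where
the sphere is curved, 1 - 1/p where it is flat of order p, and 1 along a face.
The sum of the beta i is 1 / kappa, so the box has volume
delta^d x^(-1/kappa) = 1.

Travel times are small ([travel_time_upper]): place disjoint boxes along the
ray, and visit one Poisson point in each box that has one. A visited point
saves delta / 2, the detour costs delta / 4, and a box is occupied with a
probability that does not depend on eps.

They are not smaller ([travel_time_lower]): the time of a path is at least that
of a chain of distinct Poisson points in which every step gets delta for free
([path_time_chain]). Summing [ad_low] over the steps of a chain of time less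
than s (1 - 2 x) shows that its steps are short on average in the skewed
coordinates. Cut the space into skewed cells of volume l. A given sequence of n
cells contains n distinct points in this order with probability at most l^n
([crowded_prob]), and an exponential weight turns the constraint on the steps
into a product of geometric sums ([sum_walk]). If x = C eps^kappa with C large,
the resulting series in n is geometric of ratio at most 1/2, with a prefactor
that vanishes as s grows.

Both estimates pass to mu through the convergence in mean alone
([time_constant_ge], [time_constant_le_mean]). *)

(** * The p-norm and its norming functionals *)

Lemma expR_le_quadratic (R : realType) (y : R) :
  `|y| <= 2^-1 -> expR y <= 1 + y + 2 * y ^+ 2.
Proof.
rewrite ler_norml => /andP[y1 y2].
have h : 1 - y <= expR (- y) := expR_ge1Dx (- y).
have e0 := expR_gt0 y.
have : expR y * (1 - y) <= 1.
  by rewrite -[X in _ <= X](expRxMexpNx_1 y) (ler_wpM2l (ltW e0)).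
have : 0 <= y ^+ 2 * (1 - 2 * y) by rewrite mulr_ge0 ?sqr_ge0//; lra.
move=> h2 h3.
have : expR y * (1 - y) <= (1 + y + 2 * y ^+ 2) * (1 - y) by nra.
by rewrite ler_pM2r//; lra.
Qed.

(** Bounding 1 + t by exp t reduces a real exponent to the exponential. The
linear term is exact, so that it can be cancelled by the choice of h. *)
Lemma powR_le_quadratic (R : realType) (r b h : R) : 1 <= r -> b != 0 ->
  `|r * (h / b)| <= 2^-1 ->
  `|b + h| `^ r <= `|b| `^ r * (1 + r * (h / b) + 2 * (r * (h / b)) ^+ 2).
Proof.
move=> r1 b0 hb; have r0 : 0 <= r by lra.
have -> : b + h = b * (1 + h / b) by rewrite mulrDr mulr1 mulrCA mulfV// mulr1.
have t2 : `|h / b| <= 2^-1.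
  by apply: le_trans hb; rewrite [X in _ <= X]normrM (ger0_norm r0) ler_peMl.
have t1 : 0 <= 1 + h / b by move: t2; rewrite ler_norml => /andP[? ?]; lra.
rewrite normrM (ger0_norm t1) powRM// ler_wpM2l ?powR_ge0//.
apply: le_trans (expR_le_quadratic hb).
rewrite [X in expR X]mulrC expRM.
by apply: (ge0_ler_powR r0); rewrite ?nnegrE ?expR_ge0// expR_ge1Dx.
Qed.

Lemma pnorm_fin_ge0 (R : realType) (d : nat) (r : R) (v : 'rV[R]_d) :
  0 <= \sum_(i < d) `|v 0 i| `^ r.
Proof. by apply: sumr_ge0 => i _; exact: powR_ge0. Qed.

Lemma pnorm_powR (R : realType) (d : nat) (r : R) (v : 'rV[R]_d) : 0 < r ->
  pnorm r%:E v `^ r = \sum_(i < d) `|v 0 i| `^ r.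
Proof.
move=> r0; rewrite /pnorm -powRrM mulVf ?gt_eqF// powRr1//.
exact: pnorm_fin_ge0.
Qed.

Lemma pnorm_ge0 (R : realType) (d : nat) (p : \bar R) (v : 'rV[R]_d) :
  0 <= pnorm p v.
Proof.
case: p => [r||]//=; first exact: powR_ge0.
by elim/big_ind: _ => // x y x0 y0; rewrite le_max x0.
Qed.

Lemma ler_coord_pnorm (R : realType) (d : nat) (p : \bar R) (v : 'rV[R]_d) i :
  (1 <= p)%E -> `|v 0 i| <= pnorm p v.
Proof.
case: p => [r||]//=; last by move=> _; apply: (le_bigmax _ (fun i => `|v 0 i|)).
rewrite lee_fin => r1; have r0 : 0 < r by lra.
have <- : (`|v 0 i| `^ r) `^ r^-1 = `|v 0 i|.
  by rewrite -powRrM mulfV ?gt_eqF// powRr1.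
apply: ge0_ler_powR; rewrite ?nnegrE ?invr_ge0 ?powR_ge0 ?pnorm_fin_ge0//.
  exact: ltW.
by rewrite (bigD1 i)//= lerDl sumr_ge0// => j _; exact: powR_ge0.
Qed.

Lemma pnormZ (R : realType) (d : nat) (p : \bar R) (a : R) (v : 'rV[R]_d) :
  (1 <= p)%E -> pnorm p (a *: v) = `|a| * pnorm p v.
Proof.
case: p => [r||]//=.
  rewrite lee_fin => r1; have r0 : 0 < r by lra.
  under eq_bigr do rewrite mxE normrM powRM//.
  rewrite -mulr_sumr powRM ?powR_ge0 ?pnorm_fin_ge0//.
  by rewrite -powRrM mulfV ?gt_eqF// powRr1.
move=> _; under eq_bigr do rewrite mxE normrM.
by rewrite (big_morph _ (fun x y => maxr_pMr x y (normr_ge0 a)) (mulr0 _)).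
Qed.

Definition linf (R : realType) (d : nat) (f v : 'rV[R]_d) : R :=
  \sum_i f 0 i * v 0 i.

Lemma linfD (R : realType) (d : nat) (f v w : 'rV[R]_d) :
  linf f (v + w) = linf f v + linf f w.
Proof. by rewrite -big_split/=; apply: eq_bigr => i _; rewrite mxE mulrDr. Qed.

Lemma linfZ (R : realType) (d : nat) (f : 'rV[R]_d) a v :
  linf f (a *: v) = a * linf f v.
Proof. by rewrite mulr_sumr; apply: eq_bigr => i _; rewrite mxE mulrCA. Qed.

Lemma linfDl (R : realType) (d : nat) (f g v : 'rV[R]_d) :
  linf (f + g) v = linf f v + linf g v.
Proof. by rewrite -big_split/=; apply: eq_bigr => i _; rewrite mxE mulrDl. Qed.

Lemma linf_delta (R : realType) (d : nat) (a : R) (i : 'I_d) (v : 'rV[R]_d) :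
  linf (a *: delta_mx 0 i) v = a * v 0 i.
Proof.
rewrite /linf (bigD1 i)//= big1 ?addr0; first by rewrite !mxE !eqxx mulr1.
by move=> j ji; rewrite !mxE (negbTE ji) andbF mulr0 mul0r.
Qed.

(** Young's inequality in each coordinate. Unlike in Hoelder's inequality the
dual vector enters through the q-th power of its norm, which is easier to expand
than the norm itself. *)
Lemma linf_le_young (R : realType) (d : nat) (r q : R) (g v : 'rV[R]_d) :
  0 < r -> 0 < q -> r^-1 + q^-1 = 1 ->
  linf g v <= pnorm r%:E v * (r^-1 + (\sum_i `|g 0 i| `^ q) / q).
Proof.
move=> r0 q0 rq; have [N0|N0] := eqVneq (pnorm r%:E v) 0.
  rewrite N0 mul0r.
  rewrite /linf big1// => i _.
  have : `|v 0 i| `^ r <= pnorm r%:E v `^ r.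
    by rewrite pnorm_powR// (bigD1 i)//= lerDl sumr_ge0.
  rewrite N0 powR0 ?gt_eqF// => h.
  have /powR_eq0_eq0/eqP : `|v 0 i| `^ r = 0.
    by apply/eqP; rewrite eq_le h powR_ge0.
  by rewrite normr_eq0 => /eqP->; rewrite mulr0.
set N := pnorm r%:E v in N0 *.
have Np : 0 < N by rewrite lt_neqAle eq_sym N0 pnorm_ge0.
suff : \sum_i (`|v 0 i| / N) * `|g 0 i| <= r^-1 + (\sum_i `|g 0 i| `^ q) / q.
  rewrite -(ler_pM2l Np); apply: le_trans.
  rewrite mulr_sumr; apply: ler_sum => i _.
  rewrite mulrA (mulrCA N) mulfV// mulr1 mulrC -normrM.
  exact: ler_norm.
have -> : r^-1 = \sum_i (`|v 0 i| / N) `^ r / r.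
  under eq_bigr do rewrite powRM ?invr_ge0 ?(ltW Np)//.
  rewrite -!mulr_suml -pnorm_powR//.
  by rewrite -powRM ?pnorm_ge0 ?invr_ge0 ?(ltW Np)// mulfV// powR1 mul1r.
rewrite mulr_suml -big_split/=; apply: ler_sum => i _.
by apply: conjugate_powR => //; rewrite divr_ge0// ltW.
Qed.

(** The gradient at u of the r-norm, when u has norm 1: its q-norm is 1 for the
conjugate exponent q. *)
Definition dualvec (R : realType) (d : nat) (r : R) (u : 'rV[R]_d) : 'rV[R]_d :=
  \row_i (Num.sg (u 0 i) * `|u 0 i| `^ (r - 1)).

Lemma dualvec_mul (R : realType) (d : nat) (r : R) (u : 'rV[R]_d) i : 1 <= r ->
  dualvec r u 0 i * u 0 i = `|u 0 i| `^ r.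
Proof.
move=> r1; rewrite mxE mulrAC -normrEsg mulr_powRB1//; lra.
Qed.

Lemma dualvec_powR (R : realType) (d : nat) (r q : R) (u : 'rV[R]_d) i :
  1 < r -> q = r / (r - 1) -> `|dualvec r u 0 i| `^ q = `|u 0 i| `^ r.
Proof.
move=> r1 ->; have r1' : r - 1 != 0 by rewrite subr_eq0 gt_eqF.
rewrite mxE normrM normr_sg.
have [->|u0] := eqVneq (u 0 i) 0.
  rewrite mul0r normr0 !powR0//; first by rewrite gt_eqF//; lra.
  by rewrite mulf_neq0 ?invr_eq0//; rewrite gt_eqF//; lra.
by rewrite mul1r ger0_norm ?powR_ge0// -powRrM mulrCA mulfV// mulr1.
Qed.

Lemma dualvec_neq0 (R : realType) (d : nat) (r : R) (u : 'rV[R]_d) i :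
  u 0 i != 0 -> dualvec r u 0 i != 0.
Proof.
move=> u0; rewrite mxE mulf_neq0 ?sgr_eq0// gt_eqF// powR_gt0//.
by rewrite normr_gt0.
Qed.

Lemma linf_dualvec (R : realType) (d : nat) (r : R) (u : 'rV[R]_d) : 1 <= r ->
  linf (dualvec r u) u = \sum_i `|u 0 i| `^ r.
Proof. by move=> r1; apply: eq_bigr => i _; rewrite dualvec_mul. Qed.

Lemma conjugate_exponent (R : realType) (r q : R) : 1 < r -> q = r / (r - 1) ->
  [/\ 0 < r, 1 < q & r^-1 + q^-1 = 1].
Proof.
move=> r1 ->; have r0 : 0 < r by lra.
split => //; first by rewrite ltr_pdivlMr ?mul1r; lra.
by field; rewrite subr_eq0 !gt_eqF.
Qed.

Lemma pnorm1_sum (R : realType) (d : nat) (r : R) (u : 'rV[R]_d) :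
  0 < r -> pnorm r%:E u = 1 -> \sum_i `|u 0 i| `^ r = 1.
Proof. by move=> r0 u1; rewrite -pnorm_powR// u1 powR1. Qed.

Lemma linf_dualvec_le (R : realType) (d : nat) (r : R) (u v : 'rV[R]_d) :
  1 < r -> pnorm r%:E u = 1 -> linf (dualvec r u) v <= pnorm r%:E v.
Proof.
move=> r1 u1; have [r0 q1 rq] := conjugate_exponent r1 erefl.
apply: le_trans (linf_le_young _ _ r0 (lt_trans ltr01 q1) rq) _.
under eq_bigr do rewrite dualvec_powR//.
by rewrite pnorm1_sum// mul1r rq mulr1.
Qed.

(** The norm of v + w is attained by its norming functional, which stays below
the norm on v and on w. *)
Lemma ler_pnormD (R : realType) (d : nat) (p : \bar R) (v w : 'rV[R]_d) :
  (1 <= p)%E -> pnorm p (v + w) <= pnorm p v + pnorm p w.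
Proof.
case: p => [r||]// p1; last first.
  apply: bigmax_le => [|i _]; first by rewrite addr_ge0 ?pnorm_ge0.
  by rewrite mxE (le_trans (ler_normD _ _))// lerD// ler_coord_pnorm.
move: (p1); rewrite lee_fin le_eqVlt => /predU1P[r1|r1].
  rewrite /pnorm -r1 invr1 !powRr1 ?pnorm_fin_ge0//.
  rewrite -big_split/=; apply: ler_sum => i _.
  by rewrite !powRr1// mxE ler_normD.
have [z0|z0] := eqVneq (pnorm r%:E (v + w)) 0.
  by rewrite z0 addr_ge0// pnorm_ge0.
have zp : 0 < pnorm r%:E (v + w) by rewrite lt_neqAle eq_sym z0 pnorm_ge0.
set N := pnorm r%:E (v + w) in z0 zp *; pose z := N^-1 *: (v + w).
have z1 : pnorm r%:E z = 1.
  by rewrite pnormZ// ger0_norm ?invr_ge0 ?(ltW zp)// mulVf.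
have -> : N = linf (dualvec r z) (v + w).
  have -> : v + w = N *: z by rewrite scalerA mulfV// scale1r.
  rewrite linfZ linf_dualvec ?(ltW r1)// pnorm1_sum ?mulr1//; lra.
by rewrite linfD; apply: lerD; exact: linf_dualvec_le.
Qed.

Lemma pnormN (R : realType) (d : nat) (p : \bar R) (v : 'rV[R]_d) :
  (1 <= p)%E -> pnorm p (- v) = pnorm p v.
Proof. by move=> p1; rewrite -scaleN1r pnormZ// normrN1 mul1r. Qed.

Lemma pnorm0 (R : realType) (d : nat) (p : \bar R) :
  (1 <= p)%E -> pnorm p (0 : 'rV[R]_d) = 0.
Proof. by move=> p1; rewrite -(scale0r 0) pnormZ// normr0 mul0r. Qed.

Lemma pnorm_subC (R : realType) (d : nat) (p : \bar R) (v w : 'rV[R]_d) :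
  (1 <= p)%E -> pnorm p (v - w) = pnorm p (w - v).
Proof. by move=> p1; rewrite -pnormN// opprB. Qed.

(** * Skewed boxes adapted to a direction *)

(** Coordinates in the basis obtained from the canonical one by putting u in
place of the vector of index i0: the coordinate i0 is the advance along u, and
the others vanish on the line of u. *)
Definition skew (R : realType) (d : nat) (u : 'rV[R]_d) (i0 : 'I_d)
    (v : 'rV[R]_d) (i : 'I_d) : R :=
  if i == i0 then v 0 i0 / u 0 i0 else v 0 i - u 0 i * (v 0 i0 / u 0 i0).

(** Lengths are in units of delta, so that a box has length 1 / x along u. Its
detour 1/4 is half of what a visited ball saves. *)
Record adapted (R : realType) (d : nat) (p : \bar R) (u : 'rV[R]_d)
    (i0 : 'I_d) (beta : 'I_d -> R) (f : 'rV[R]_d) (c : R) : Prop := Adapted {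
  ad_u : u 0 i0 != 0;
  ad_beta0 : beta i0 = 1;
  ad_beta : forall i, 0 <= beta i;
  ad_f : linf f u = 1;
  ad_c : 0 < c;
  ad_low : forall x v, 0 < x <= 1 ->
    linf f v + c * (\sum_i x `^ beta i * `|skew u i0 v i|)
      <= (1 + x) * pnorm p v;
  ad_up : forall x v, 0 < x <= 1 ->
    (forall i, i != i0 -> `|skew u i0 v i| <= c * x `^ (- beta i)) ->
    x^-1 <= skew u i0 v i0 -> pnorm p v <= linf f v + 4^-1 }.

Lemma skewD (R : realType) (d : nat) (u : 'rV[R]_d) i0 v w i :
  skew u i0 (v + w) i = skew u i0 v i + skew u i0 w i.
Proof. by rewrite /skew; case: ifP => _; rewrite !mxE; ring. Qed.

Lemma skewZ (R : realType) (d : nat) (u : 'rV[R]_d) i0 a v i :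
  skew u i0 (a *: v) i = a * skew u i0 v i.
Proof. by rewrite /skew; case: ifP => _; rewrite !mxE; ring. Qed.

Lemma skewB (R : realType) (d : nat) (u : 'rV[R]_d) i0 v w i :
  skew u i0 (v - w) i = skew u i0 v i - skew u i0 w i.
Proof. by rewrite -scaleN1r skewD skewZ mulN1r. Qed.

Lemma skew_dir (R : realType) (d : nat) (u : 'rV[R]_d) i0 i : u 0 i0 != 0 ->
  skew u i0 u i = (i == i0)%:R.
Proof. by move=> u0; rewrite /skew; case: ifP; rewrite divff ?mulr1 ?subrr. Qed.

Lemma coord_skew (R : realType) (d : nat) (u v : 'rV[R]_d) i0 i : u 0 i0 != 0 ->
  v 0 i = u 0 i * skew u i0 v i0 + (i != i0)%:R * skew u i0 v i.
Proof.
move=> u0; rewrite /skew eqxx; case: eqP => [->|_] /=; last by ring.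
by rewrite mul0r addr0 mulrCA mulfV// mulr1.
Qed.

Lemma exists_pos_lower_bound (R : realType) (d : nat) (F : 'I_d -> R) :
  (forall i, 0 < F i) -> exists2 c, 0 < c & forall i, c <= F i.
Proof.
move=> F0; pose s := \sum_i (F i)^-1.
have s0 : 0 <= s by apply: sumr_ge0 => i _; rewrite invr_ge0 ltW.
exists (1 + s)^-1 => [|i]; first by rewrite invr_gt0; lra.
rewrite -[leRHS]invrK lef_pV2 ?posrE ?invr_gt0//; last by lra.
rewrite {}/s in s0 *; rewrite (bigD1 i)//=.
suff: 0 <= \sum_(j < d | j != i) (F j)^-1 by lra.
by apply: sumr_ge0 => j _; rewrite invr_ge0 ltW.
Qed.

(** It suffices to certify the coordinates one at a time: the certificates are
averaged. *)
Lemma adapted_of_coord (R : realType) (d : nat) (p : \bar R) (u : 'rV[R]_d)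
    (i0 : 'I_d) (beta : 'I_d -> R) (f : 'rV[R]_d) : (1 <= p)%E ->
  u 0 i0 != 0 -> beta i0 = 1 -> (forall i, 0 <= beta i) -> linf f u = 1 ->
  (forall i, exists2 c, 0 < c & forall x v, 0 < x <= 1 ->
    linf f v + c * (x `^ beta i * `|skew u i0 v i|) <= (1 + x) * pnorm p v) ->
  (exists2 c, 0 < c & forall x v, 0 < x <= 1 ->
    (forall i, i != i0 -> `|skew u i0 v i| <= c * x `^ (- beta i)) ->
    x^-1 <= skew u i0 v i0 -> pnorm p v <= linf f v + 4^-1) ->
  exists c, adapted p u i0 beta f c.
Proof.
move=> p1 u0 b0 bge fu low [c1 c10 up].
pose c i := sval (cid2 (low i)).
have c0 i : 0 < c i by rewrite /c; case: cid2.
have cP i : forall x v, 0 < x <= 1 ->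
    linf f v + c i * (x `^ beta i * `|skew u i0 v i|) <= (1 + x) * pnorm p v.
  by rewrite /c; case: cid2.
pose s := \sum_i (c i)^-1.
have s0 : 0 < s.
  rewrite /s (bigD1 i0)//=.
  have : 0 < (c i0)^-1 by rewrite invr_gt0.
  have : 0 <= \sum_(i < d | i != i0) (c i)^-1.
    by apply: sumr_ge0 => j _; rewrite invr_ge0 ltW.
  by lra.
exists (Num.min s^-1 c1); split => //.
- by rewrite lt_min invr_gt0 s0.
- move=> x v x01.
  have : linf f v + s^-1 * (\sum_i x `^ beta i * `|skew u i0 v i|)
      <= (1 + x) * pnorm p v.
    rewrite -(ler_pM2l s0) mulrDr mulrA mulfV ?gt_eqF// mul1r.
    rewrite /s !mulr_suml -big_split/=; apply: ler_sum => i _.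
    rewrite -(ler_pM2l (c0 i)) mulrDr 2!mulrA mulfV ?gt_eqF// mul1r.
    by rewrite mul1r cP.
  apply: le_trans; rewrite lerD2l ler_wpM2r ?ge_min ?lexx//.
  by apply: sumr_ge0 => i _; rewrite mulr_ge0// powR_ge0.
- move=> x v x01 h; apply: (up _ _ x01) => i ii0; apply: le_trans (h i ii0) _.
  by rewrite ler_wpM2r ?powR_ge0// ge_min lexx orbT.
Qed.

Lemma skew_le_pnorm (R : realType) (d : nat) (p : \bar R) (u v : 'rV[R]_d)
    i0 i : (1 <= p)%E ->
  `|skew u i0 v i| <= (1 + `|u 0 i0|^-1 + `|u 0 i| / `|u 0 i0|) * pnorm p v.
Proof.
move=> p1; have vi := ler_coord_pnorm v i p1; have v0 := ler_coord_pnorm v i0 p1.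
have N0 := pnorm_ge0 p v; have u0 : 0 <= `|u 0 i0|^-1 by rewrite invr_ge0.
have u1 := normr_ge0 (u 0 i).
have A : `|v 0 i0 / u 0 i0| <= `|u 0 i0|^-1 * pnorm p v.
  by rewrite normrM normfV mulrC ler_wpM2l.
have B : 0 <= `|u 0 i| * `|u 0 i0|^-1 * pnorm p v by rewrite !mulr_ge0.
have D : 0 <= `|u 0 i0|^-1 * pnorm p v by rewrite mulr_ge0.
rewrite /skew; case: ifP => _; first by rewrite !mulrDl; lra.
apply: le_trans (ler_normB _ _) _; rewrite normrM.
have : `|u 0 i| * `|v 0 i0 / u 0 i0| <= `|u 0 i| * (`|u 0 i0|^-1 * pnorm p v).
  exact: ler_wpM2l.
by rewrite !mulrDl; lra.
Qed.

(** In a direction as wide as the box is long there is no loss to detect: the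
charge is of the order of x times the norm, and the factor 1 + x pays for it. *)
Lemma low_widest (R : realType) (d : nat) (p : \bar R) (u f : 'rV[R]_d)
    i0 i (beta : R) : (1 <= p)%E -> u 0 i0 != 0 -> beta = 1 ->
  (forall v, linf f v <= pnorm p v) ->
  exists2 c, 0 < c & forall x v, 0 < x <= 1 ->
    linf f v + c * (x `^ beta * `|skew u i0 v i|) <= (1 + x) * pnorm p v.
Proof.
move=> p1 u0 -> fN.
set A := 1 + `|u 0 i0|^-1 + `|u 0 i| / `|u 0 i0|.
have A0 : 0 < A.
  rewrite /A; have : 0 <= `|u 0 i0|^-1 by rewrite invr_ge0.
  have : 0 <= `|u 0 i| / `|u 0 i0| by rewrite mulr_ge0// invr_ge0.
  by lra.
exists A^-1 => [|x v /andP[x0 x1]]; first by rewrite invr_gt0.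
rewrite powRr1 ?(ltW x0)// mulrDl mul1r; apply: lerD => //.
rewrite mulrCA ler_wpM2l ?(ltW x0)// mulrC ler_pdivrMr// mulrC.
exact: skew_le_pnorm.
Qed.

Lemma pnorm1E (R : realType) (d : nat) (v : 'rV[R]_d) :
  pnorm 1%:E v = \sum_i `|v 0 i|.
Proof.
rewrite /pnorm invr1 powRr1 ?pnorm_fin_ge0//.
by apply: eq_bigr => i _; rewrite powRr1.
Qed.

Lemma pnorm_neq0_coord (R : realType) (d : nat) (p : \bar R) (u : 'rV[R]_d) :
  (1 <= p)%E -> pnorm p u = 1 -> exists i, u 0 i != 0.
Proof.
move=> p1 u1; apply: contrapT => h.
suff u0 : u = 0 by move: u1; rewrite u0 pnorm0// => /eqP; rewrite eq_sym oner_eq0.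
apply/rowP => i; rewrite mxE; apply/eqP; apply: contrapT => ui.
by apply: h; exists i; apply/negP.
Qed.

Lemma sum_bool_card (R : realType) (d : nat) (P : pred 'I_d) :
  \sum_i (P i)%:R = #|[set i | P i]%SET|%:R :> R.
Proof.
rewrite -natr_sum; congr (_%:R); rewrite -sum1_card [RHS]big_mkcond/=.
by apply: eq_bigr => i _; rewrite inE; case: (P i).
Qed.

(** A coordinate of v where u vanishes is lost entirely, hence a box of bounded
width there. Where u does not vanish nothing is lost as long as the signs are
those of u. *)
Lemma adapted_one (R : realType) (d : nat) (u : 'rV[R]_d) : pnorm 1%:E u = 1 ->
  exists i0 beta f c, adapted 1%:E u i0 beta f c /\
    kappa 1%:E u = (\sum_i beta i)^-1.
Proof.
move=> u1; have p1 : (1 <= 1%:E :> \bar R)%E by [].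
have [i0 ui0] := pnorm_neq0_coord p1 u1.
pose beta i : R := (u 0 i != 0)%:R.
pose f : 'rV[R]_d := \row_i Num.sg (u 0 i).
have fi (v : 'rV[R]_d) i : f 0 i * v 0 i <= `|v 0 i|.
  rewrite mxE; apply: le_trans (ler_norm _) _; rewrite normrM normr_sg.
  by case: eqP => _; rewrite ?mul0r ?mul1r.
exists i0, beta, f.
have fu : linf f u = 1.
  rewrite -[RHS]u1 pnorm1E; apply: eq_bigr => i _.
  by rewrite mxE -normrEsg.
have [|i||i||c cP] := @adapted_of_coord _ _ 1%:E u i0 beta f p1 ui0.
- by rewrite /beta ui0.
- by rewrite /beta.
- exact: fu.
- have [ui|ui] := eqVneq (u 0 i) 0; last first.
    apply: low_widest => //; first by rewrite /beta ui.
    by move=> v; rewrite pnorm1E; apply: ler_sum.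
  exists 1 => // x v /andP[x0 x1].
  have ii0 : i != i0 by apply: contra_neq ui0 => <-.
  rewrite /beta ui eqxx powRr0 !mul1r /skew (negbTE ii0) ui mul0r subr0.
  apply: (@le_trans _ _ (pnorm 1%:E v)).
    rewrite pnorm1E /linf (bigD1 i)//= [leRHS](bigD1 i)//= [f 0 i]mxE ui sgr0.
    by rewrite mul0r add0r addrC; apply: lerD => //; apply: ler_sum.
  by rewrite mulrDl mul1r lerDl mulr_ge0 ?pnorm_ge0// ltW.
- have [c c0 cP] : exists2 c, 0 < c &
    forall i, c <= if u 0 i == 0 then (4 * d%:R)^-1 else `|u 0 i|.
    apply: exists_pos_lower_bound => i; case: eqP => [_|/eqP].
      by rewrite invr_gt0 mulr_gt0// ltr0n (leq_ltn_trans (leq0n _) (ltn_ord i)).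
    by rewrite normr_gt0.
  exists c => // x v /andP[x0 x1] h t0.
  have t1 : 0 < skew u i0 v i0 by apply: lt_le_trans t0; rewrite invr_gt0.
  have d0 : (0 < d%:R :> R) by rewrite ltr0n (leq_ltn_trans (leq0n _) (ltn_ord i0)).
  have -> : 4^-1 = \sum_(i < d) (4 * d%:R)^-1 :> R.
    by rewrite sumr_const card_ord -mulr_natr; field; rewrite gt_eqF.
  rewrite pnorm1E -big_split/=; apply: ler_sum => i _; rewrite mxE.
  have [ui|ui] := eqVneq (u 0 i) 0.
    rewrite ui sgr0 mul0r add0r.
    have ii0 : i != i0 by apply: contra_neq ui0 => <-.
    have := h i ii0; rewrite /beta ui eqxx oppr0 powRr0 mulr1.
    rewrite /skew (negbTE ii0) ui mul0r subr0 => /le_trans; apply.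
    by have := cP i; rewrite ui eqxx.
  suff -> : `|v 0 i| = Num.sg (u 0 i) * v 0 i.
    by rewrite lerDl invr_ge0 mulr_ge0// ltW.
  suff sv : 0 <= Num.sg (u 0 i) * v 0 i.
    rewrite -[RHS](ger0_norm sv) normrM normr_sg ui mul1r//.
  rewrite (coord_skew v i ui0) mulrDr mulrA -normrEsg.
  suff : `|Num.sg (u 0 i) * ((i != i0)%:R * skew u i0 v i)| <=
     `|u 0 i| * skew u i0 v i0.
    by rewrite ler_norml => /andP[? _]; lra.
  rewrite normrM normr_sg ui mul1r normrM.
  have [->|ii0] := eqVneq i i0.
    by rewrite normr0 mul0r mulr_ge0// ltW.
  rewrite normr1 mul1r; apply: le_trans (h i ii0) _.
  rewrite /beta ui powR_inv1 ?(ltW x0)//.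
  by apply: ler_pM => //; rewrite ?invr_ge0 ?(ltW c0) ?(ltW x0)//; have := cP i; rewrite (negbTE ui).
- exists c; split => //.
  by rewrite /kappa eqxx /d1 sum_bool_card.
Qed.

(** The norming functional averages the coordinates of u of modulus 1: those of
v must be equal up to a bounded error, while the other ones are free up to a
multiple of the advance. *)
Lemma adapted_infty (R : realType) (d : nat) (u : 'rV[R]_d) : pnorm +oo%E u = 1 ->
  exists i0 beta f c, adapted +oo%E u i0 beta f c /\
    kappa +oo%E u = (\sum_i beta i)^-1.
Proof.
move=> u1; have p1 : (1 <= +oo :> \bar R)%E by rewrite leey.
have ule i : `|u 0 i| <= 1 by rewrite -u1 ler_coord_pnorm.
have [i0 i01] : exists i, `|u 0 i| = 1.
  apply: contrapT => h; suff : pnorm +oo%E u < 1 by rewrite u1 ltxx.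
  rewrite /pnorm; apply: bigmax_lt => // i _.
  rewrite lt_neqAle ule andbT; apply/eqP => ui; apply: h; by exists i.
have ui0 : u 0 i0 != 0 by rewrite -normr_eq0 i01 oner_neq0.
pose S i := `|u 0 i| == 1.
have Si0 : S i0 by rewrite /S i01.
pose D : R := \sum_(i | S i) 1.
have D0 : 0 < D.
  rewrite /D (bigD1 i0)//=; have : 0 <= \sum_(i < d | S i && (i != i0)) 1 :> R.
    exact: sumr_ge0.
  by lra.
pose f : 'rV[R]_d := \row_i (if S i then Num.sg (u 0 i) / D else 0).
have fE v : linf f v = D^-1 * \sum_(i | S i) Num.sg (u 0 i) * v 0 i.
  rewrite mulr_sumr [RHS]big_mkcond; apply: eq_bigr => i _.
  by rewrite mxE; case: ifP => _; rewrite ?mul0r//; ring.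
have fN v : pnorm +oo%E v - linf f v =
    D^-1 * \sum_(i | S i) (pnorm +oo%E v - Num.sg (u 0 i) * v 0 i).
  rewrite big_split/= sumrN mulrDr mulrN -fE; congr (_ - _).
  by rewrite (_ : \sum_(i | S i) _ = D * pnorm +oo%E v) ?mulKf ?gt_eqF// mulr_suml;
    under [RHS]eq_bigr do rewrite mul1r.
have sgN (v : 'rV[R]_d) i : 0 <= pnorm +oo%E v - Num.sg (u 0 i) * v 0 i.
  rewrite subr_ge0; apply: le_trans (ler_norm _) _.
  apply: (@le_trans _ _ `|v 0 i|); last exact: ler_coord_pnorm.
  by rewrite normrM normr_sg; case: eqP => _; rewrite ?mul0r ?mul1r.
have fle v : linf f v <= pnorm +oo%E v.
  by rewrite -subr_ge0 fN mulr_ge0 ?invr_ge0 ?(ltW D0)//; apply: sumr_ge0.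
have sgu i : S i -> Num.sg (u 0 i) = u 0 i.
  by move=> /eqP Si; rewrite [RHS]numEsg Si mulr1.
have uu i : S i -> u 0 i * u 0 i = 1.
  by move=> Si; rewrite -{1}(sgu i Si) -normrEsg; apply/eqP.
pose beta i : R := if (i == i0) || ~~ S i then 1 else 0.
have fu : linf f u = 1.
  rewrite fE; under eq_bigr => i Si do rewrite sgu// uu//.
  by rewrite mulVf ?gt_eqF.
exists i0, beta, f.
have [|i||i||c cP] := @adapted_of_coord _ _ +oo%E u i0 beta f p1 ui0.
- by rewrite /beta eqxx.
- by rewrite /beta; case: ifP.
- exact: fu.
- rewrite /beta; case: ifPn => [_|]; first exact: low_widest.
  rewrite negb_or negbK => /andP[ii0 Si].
  exists D^-1 => [|x v /andP[x0 x1]]; first by rewrite invr_gt0.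
  rewrite powRr0 mul1r /skew (negbTE ii0).
  apply: (@le_trans _ _ (pnorm +oo%E v)); last first.
    by rewrite mulrDl mul1r lerDl mulr_ge0 ?pnorm_ge0// ltW.
  rewrite addrC -lerBrDr fN ler_wpM2l ?invr_ge0 ?(ltW D0)//.
  have -> : `|v 0 i - u 0 i * (v 0 i0 / u 0 i0)| =
            `|Num.sg (u 0 i) * v 0 i - Num.sg (u 0 i0) * v 0 i0|.
    rewrite (sgu i0)// -[RHS]mul1r -(eqP Si) -[RHS]normrM mulrBr mulrA.
    rewrite (sgu i)// !mulrA uu// mul1r.
    have iu : (u 0 i0)^-1 = u 0 i0 by rewrite -[LHS]mul1r -(uu i0)// mulfK.
    by rewrite iu mulrAC.
  move: (pnorm +oo%E v) (sgN v) => m sgv.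
  rewrite (bigD1 i)//= (bigD1 i0) ?Si0 ?[i0 == i]eq_sym ?ii0//=.
  have A := sgv i; have B := sgv i0.
  set a := Num.sg (u 0 i) * _ in A *; set b := Num.sg (u 0 i0) * _ in B *.
  have C : 0 <= \sum_(i1 < d | S i1 && (i1 != i) && (i1 != i0))
     (m - Num.sg (u 0 i1) * v 0 i1) by apply: sumr_ge0.
  by rewrite ler_norml; lra.
- have [c c0 cP] : exists2 c, 0 < c &
    forall i, c <= if S i then 8^-1 else 1 - `|u 0 i|.
    apply: exists_pos_lower_bound => i; case: ifPn => // Si.
    by rewrite subr_gt0 lt_neqAle ule andbT.
  have c8 : c <= 8^-1 by have := cP i0; rewrite Si0.
  exists c => // x v /andP[x0 x1] h t0.
  have t1 : 0 < skew u i0 v i0 by apply: lt_le_trans t0; rewrite invr_gt0.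
  have St i : S i -> `|v 0 i - u 0 i * skew u i0 v i0| <= c.
    move=> Si; rewrite (coord_skew v i ui0) addrC addKr.
    have [->|ii0] := eqVneq i i0; first by rewrite mul0r normr0 ltW.
    rewrite mul1r; apply: le_trans (h i ii0) _.
    by rewrite /beta Si (negbTE ii0) oppr0 powRr0 mulr1.
  have ft : skew u i0 v i0 - c <= linf f v.
    rewrite fE mulrC ler_pdivlMr// /D mulr_sumr; apply: ler_sum => i Si.
    rewrite mulr1; have := St i Si; rewrite -[`|_|]mul1r -(eqP Si) -normrM mulrBr.
    by rewrite mulrA uu// mul1r sgu// ler_norml => /andP[]; lra.
  apply: bigmax_le => [|i _]; first by lra.
  have [Si|Si] := boolP (S i).
    apply: (@le_trans _ _ (c + skew u i0 v i0)); last by lra.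
    have -> : v 0 i = (v 0 i - u 0 i * skew u i0 v i0) + u 0 i * skew u i0 v i0.
      by rewrite subrK.
    apply: le_trans (ler_normD _ _) _; apply: lerD; first exact: St.
    by rewrite normrM (eqP Si) mul1r gtr0_norm.
  have ii0 : i != i0 by apply: contraNneq Si => ->.
  apply: (@le_trans _ _ (skew u i0 v i0)); last by lra.
  rewrite (coord_skew v i ui0) ii0 mul1r; apply: le_trans (ler_normD _ _) _.
  rewrite normrM (gtr0_norm t1).
  have : `|skew u i0 v i| <= c * skew u i0 v i0.
    apply: le_trans (h i ii0) _; rewrite /beta Si orbT powR_inv1 ?(ltW x0)//.
    by rewrite ler_wpM2l// ltW.
  have := cP i; rewrite (negbTE Si) => ci.
  have : c * skew u i0 v i0 <= (1 - `|u 0 i|) * skew u i0 v i0.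
    by rewrite ler_wpM2r// ltW.
  by lra.
- exists c; split => //; rewrite /kappa /d4 /d3 u1; congr (_ ^-1).
  have -> : #|[set i | `|u 0 i| == 1]%SET| = #|[set i | S i]%SET| by [].
  have -> : \sum_i beta i = \sum_(i < d) ((i == i0)%:R + (~~ S i)%:R) :> R.
    apply: eq_bigr => i _; rewrite /beta.
    by have [->|ii0] := eqVneq i i0; rewrite ?Si0 /= ?addr0 ?add0r//; case: (S i).
  rewrite big_split/= !sum_bool_card.
  rewrite (_ : [set i | i == i0]%SET = [set i0]%SET) ?cards1; last first.
    by apply/setP => i; rewrite !inE.
  rewrite [RHS]addrC (_ : [set i | ~~ S i]%SET = (~: [set i | S i])%SET).
    by rewrite [in RHS]cardsCs finset.setCK card_ord.
  by apply/setP => i; rewrite !inE.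
Qed.

(** A dual vector slightly outside the unit ball of the q-norm bounds the norm up
to the same factor; the lower bounds across u for 1 < r are obtained in this way. *)
Lemma linf_le_slack (R : realType) (d : nat) (r q x : R) (g v : 'rV[R]_d) :
  0 < r -> 0 < q -> r^-1 + q^-1 = 1 -> 0 <= x ->
  \sum_i `|g 0 i| `^ q <= 1 + x -> linf g v <= (1 + x) * pnorm r%:E v.
Proof.
move=> r0 q0 rq x0 gx; apply: le_trans (linf_le_young g v r0 q0 rq) _.
rewrite mulrC ler_wpM2r ?pnorm_ge0//.
apply: (@le_trans _ _ (r^-1 + (1 + x) / q)).
  by rewrite lerD2l ler_wpM2r// invr_ge0 ltW.
rewrite mulrDl mul1r addrA rq lerD2l ler_piMr//.
have : 0 < r^-1 by rewrite invr_gt0.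
by lra.
Qed.

(** The norming functional is perturbed by h in a direction that kills u. In
the q-th power of its q-norm the first order term vanishes and the second is of
order h ^+ 2, so that h may be of order x `^ (1/2). *)
Lemma low_curved (R : realType) (d : nat) (r : R) (u : 'rV[R]_d) i0 i :
  1 < r -> pnorm r%:E u = 1 -> u 0 i0 != 0 -> u 0 i != 0 -> i != i0 ->
  exists2 c, 0 < c & forall x v, 0 < x <= 1 ->
    linf (dualvec r u) v + c * (x `^ 2^-1 * `|skew u i0 v i|)
      <= (1 + x) * pnorm r%:E v.
Proof.
move=> r1 u1 ui0 ui ii0; pose q := r / (r - 1).
have [r0 q1 rq] := conjugate_exponent r1 (erefl q); have q0 : 0 < q by lra.
pose f := dualvec r u; pose a := u 0 i / u 0 i0.
have fi := dualvec_neq0 r ui; have fi0 := dualvec_neq0 r ui0.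
pose s := `|f 0 i|^-1 + `|a| / `|f 0 i0|.
have s0 : 0 < s.
  rewrite /s; have : 0 < `|f 0 i|^-1 by rewrite invr_gt0 normr_gt0.
  have : 0 <= `|a| / `|f 0 i0| by rewrite divr_ge0.
  by lra.
pose c := (2 * q * s)^-1.
have c0 : 0 < c.
  by rewrite invr_gt0; apply: mulr_gt0 => //; apply: mulr_gt0.
exists c => // x v /andP[x0 x1].
pose t := x `^ 2^-1; have t0 : 0 < t by rewrite powR_gt0.
have tt : t * t = x.
  by rewrite /t -powRD ?gt_eqF ?implybT// -div1r -splitr powRr1// ltW.
have t1 : t <= 1 by nra.
pose h := c * Num.sg (skew u i0 v i) * t.
have hle : `|h| <= c * t.
  rewrite !normrM (gtr0_norm c0) (gtr0_norm t0) normr_sg -mulrA ler_pM2l//.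
  by case: eqP; rewrite ?mul0r ?mul1r// ltW.
pose g : 'rV[R]_d := f + h *: delta_mx 0 i + (- (h * a)) *: delta_mx 0 i0.
have gv : linf g v = linf f v + c * (t * `|skew u i0 v i|).
  rewrite !linfDl !linf_delta -addrA; congr (_ + _).
  rewrite [in RHS]normrEsg /h /a /skew (negbTE ii0).
  by field.
rewrite -/t -gv; apply: (linf_le_slack v r0 q0 rq (ltW x0)).
have perturb j b : f 0 j != 0 -> `|f 0 j|^-1 * `|b| <= t * (2 * q)^-1 ->
    `|f 0 j + b| `^ q <= `|f 0 j| `^ q + q * b * u 0 j + x / 2.
  move=> fj hb; pose y := q * (b / f 0 j).
  have ylt : `|y| <= t / 2.
    rewrite normrM (gtr0_norm q0) normrM normfV (mulrC `|b|).
    apply: le_trans (ler_wpM2l (ltW q0) hb) _.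
    by rewrite invfM mulrCA (mulrCA q) mulfV ?gt_eqF// mulr1.
  have yx : y ^+ 2 <= x / 4.
    have := normr_ge0 y; rewrite -(real_normK (num_real y)) -tt; nra.
  have y2 : `|y| <= 2^-1 by lra.
  apply: le_trans (powR_le_quadratic (ltW q1) fj y2) _.
  have A : `|f 0 j| `^ q = f 0 j * u 0 j.
    by rewrite dualvec_powR// dualvec_mul// ltW.
  have A1 : `|f 0 j| `^ q <= 1.
    rewrite dualvec_powR// -(pnorm1_sum r0 u1) (bigD1 j)//= lerDl.
    by apply: sumr_ge0 => k _; exact: powR_ge0.
  have A0 : 0 <= `|f 0 j| `^ q by exact: powR_ge0.
  rewrite mulrDr mulrDr mulr1; apply: lerD; last first.
    by rewrite -/y; have := sqr_ge0 y; nra.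
  rewrite lerD2l {1}A le_eqVlt; apply/orP; left; apply/eqP.
  by field.
have key (j : 'I_d) (b : R) : `|f 0 j|^-1 * `|b| <= s -> `|f 0 j|^-1 * (`|b| * `|h|) <= t * (2 * q)^-1.
  move=> hs; have b0 : 0 <= `|f 0 j|^-1 * `|b| by rewrite mulr_ge0 ?invr_ge0.
  rewrite mulrA; apply: le_trans (ler_pM b0 (normr_ge0 h) hs hle) _.
  rewrite /c invfM (mulrC (2 * q)^-1) !mulrA mulfV ?gt_eqF// mul1r mulrC.
  exact: lexx.
have E0 : 0 <= `|a| / `|f 0 i0| by rewrite divr_ge0.
have E1 : 0 <= `|f 0 i|^-1 by rewrite invr_ge0.
have hi : `|f 0 i + h| `^ q <= `|f 0 i| `^ q + q * h * u 0 i + x / 2.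
  apply: perturb => //; have := key i 1; rewrite normr1 mul1r mulr1; apply.
  by rewrite /s; lra.
have hi0 : `|f 0 i0 + - (h * a)| `^ q <=
    `|f 0 i0| `^ q + q * - (h * a) * u 0 i0 + x / 2.
  apply: perturb => //; rewrite normrN normrM (mulrC `|h|); apply: key.
  by rewrite /s mulrC; lra.
have F1 : \sum_j `|f 0 j| `^ q = 1.
  by under eq_bigr do rewrite dualvec_powR//; rewrite pnorm1_sum.
have gj j : g 0 j = f 0 j + (if j == i then h else if j == i0 then - (h * a) else 0).
  rewrite !mxE !eqxx /=; have [->|ji] := eqVneq j i; first by rewrite (negbTE ii0) /=; ring.
  by have [->|_] := eqVneq j i0; rewrite /=; ring.
rewrite (bigD1 i)//= (bigD1 i0) /=; last by rewrite eq_sym.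
rewrite !gj eqxx eq_sym (negbTE ii0) eqxx.
under eq_bigr => j /andP[ji ji0] do rewrite gj (negbTE ji) (negbTE ji0) addr0.
move: F1; rewrite (bigD1 i)//= (bigD1 i0) /=; last by rewrite eq_sym.
have : q * - (h * a) * u 0 i0 + q * h * u 0 i = 0.
  by rewrite /a; field.
by lra.
Qed.

(** Where u vanishes a perturbation h adds exactly |h| `^ q to the q-th power of the
q-norm, which allows h = x `^ (1 - 1/r), q being conjugate to r. *)
Lemma low_flat (R : realType) (d : nat) (r : R) (u : 'rV[R]_d) i0 i :
  1 < r -> pnorm r%:E u = 1 -> u 0 i0 != 0 -> u 0 i = 0 ->
  exists2 c, 0 < c & forall x v, 0 < x <= 1 ->
    linf (dualvec r u) v + c * (x `^ (1 - r^-1) * `|skew u i0 v i|)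
      <= (1 + x) * pnorm r%:E v.
Proof.
move=> r1 u1 ui0 ui; pose q := r / (r - 1).
have [r0 q1 rq] := conjugate_exponent r1 (erefl q); have q0 : 0 < q by lra.
have ii0 : i != i0 by apply: contra_neq ui0 => <-.
exists 1 => // x v /andP[x0 x1].
rewrite mul1r /skew (negbTE ii0) ui mul0r subr0.
pose f := dualvec r u.
pose h := Num.sg (v 0 i) * x `^ (1 - r^-1).
pose g : 'rV[R]_d := f + h *: delta_mx 0 i.
have -> : linf f v + x `^ (1 - r^-1) * `|v 0 i| = linf g v.
  by rewrite linfDl linf_delta /h [in LHS]normrEsg; ring.
apply: (linf_le_slack v r0 q0 rq (ltW x0)).
have f0 : f 0 i = 0 by rewrite mxE ui sgr0 mul0r.
have F1 : \sum_j `|f 0 j| `^ q = 1.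
  by under eq_bigr do rewrite dualvec_powR//; rewrite pnorm1_sum.
have gi : `|g 0 i| `^ q <= x.
  rewrite !mxE -/(f 0 i) !eqxx mulr1 ui sgr0 mul0r add0r /h normrM normr_sg.
  rewrite (ger0_norm (powR_ge0 _ _)).
  have -> : 1 - r^-1 = q^-1 by lra.
  case: eqP => _; first by rewrite mul0r powR0 ?gt_eqF// ltW.
  by rewrite mul1r -powRrM mulVf ?gt_eqF// powRr1// ltW.
rewrite (bigD1 i)//= addrC; apply: lerD => //.
rewrite -F1 [leRHS](bigD1 i)//=.
under eq_bigr => j ji do rewrite !mxE (negbTE ji) andbF mulr0 addr0.
under [X in _ <= _ + X]eq_bigr => j ji do rewrite mxE.
by rewrite lerDr powR_ge0.
Qed.

(** Second order expansion of a coordinate about its value on the line of u.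
Multiplied by the advance, the errors remain bounded. *)
Lemma powR_coord_le (R : realType) (d : nat) (r : R) (u v : 'rV[R]_d) i0 i c x e :
  1 < r -> pnorm r%:E u = 1 -> u 0 i0 != 0 -> 0 < c <= 1 -> 0 < x <= 1 ->
  (u 0 i != 0 -> r * c / `|u 0 i| <= e) -> c <= e -> e <= 2^-1 ->
  (i != i0 -> `|skew u i0 v i| <=
     c * x `^ - (if u 0 i == 0 then 1 - r^-1 else 2^-1)) ->
  x^-1 <= skew u i0 v i0 ->
  `|v 0 i| `^ r <= skew u i0 v i0 `^ r *
    (`|u 0 i| `^ r + r * dualvec r u 0 i * (v 0 i / skew u i0 v i0 - u 0 i)
      + e / skew u i0 v i0).
Proof.
move=> r1 u1 ui0 /andP[c0 c1] /andP[x0 x1] ce1 ce2 e2 h t0.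
have r0 : 0 < r by lra.
set t := skew u i0 v i0 in t0 *.
have x'0 : 0 < x^-1 by rewrite invr_gt0.
have tp : 0 < t by lra.
have tx : t^-1 <= x by rewrite -[leRHS]invrK lef_pV2 ?posrE.
have ti0 : 0 < t^-1 by rewrite invr_gt0.
pose z := v 0 i - u 0 i * t.
have vE : v 0 i = t * (u 0 i + z / t) by rewrite /z; field; rewrite gt_eqF.
have zc : `|z| <= c * x `^ - (if u 0 i == 0 then 1 - r^-1 else 2^-1).
  have [ii0|ii0] := eqVneq i i0.
    rewrite /z /t ii0 /skew eqxx mulrCA mulfV// mulr1 subrr normr0.
    by rewrite mulr_ge0 ?powR_ge0// ltW.
  by have := h ii0; rewrite {1}/skew (negbTE ii0) /z /t /skew eqxx.
rewrite {1}vE normrM (gtr0_norm tp) powRM ?(ltW tp)// ler_pM2l ?powR_gt0//.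
have -> : v 0 i / t - u 0 i = z / t by rewrite /z; field; rewrite gt_eqF.
have [ui|ui] := eqVneq (u 0 i) 0.
  rewrite mxE ui sgr0 !(mul0r, mulr0) normr0 powR0 ?gt_eqF// !add0r.
  move: zc; rewrite ui eqxx opprB => zc.
  rewrite normrM (gtr0_norm ti0).
  have A : `|z| / t <= c * (t `^ - r^-1).
    have tt : t * t `^ (- r^-1) = t `^ (1 - r^-1).
      by rewrite powRD ?(gt_eqF tp) ?implybT// powRr1// ltW.
    rewrite ler_pdivrMr// -mulrA (mulrC _ t) tt.
    apply: le_trans zc _; rewrite ler_wpM2l ?(ltW c0)//.
    have -> : x `^ (r^-1 - 1) = (x^-1) `^ (1 - r^-1).
      have -> : x^-1 = x `^ (-1) by rewrite powR_inv1// ltW.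
      by rewrite -powRrM mulN1r opprB.
    apply: ge0_ler_powR; rewrite ?nnegrE ?(ltW tp) ?(ltW x'0)//.
    by rewrite subr_ge0 invf_le1// ltW.
  apply: (@le_trans _ _ ((c * t `^ - r^-1) `^ r)).
    apply: ge0_ler_powR; rewrite ?nnegrE ?(ltW r0)//.
      by rewrite mulr_ge0// ltW.
    by rewrite mulr_ge0 ?powR_ge0// ltW.
  rewrite powRM ?powR_ge0 ?(ltW c0)// -powRrM mulNr mulVf ?gt_eqF//.
  rewrite powR_inv1 ?(ltW tp)// ler_wpM2r ?(ltW ti0)//.
  by apply: le_trans ce2; apply: ge1r_powR; rewrite ?c0// ltW.
move: zc; rewrite (negbTE ui) => zc.
pose w := x `^ 2^-1; have w0 : 0 < w by rewrite powR_gt0.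
have ww : w * w = x.
  by rewrite /w -powRD ?gt_eqF ?implybT// -div1r -splitr powRr1// ltW.
have w1 : w <= 1 by nra.
have {}zc : `|z| * w <= c.
  by rewrite -ler_pdivlMr//; move: zc; rewrite powRN.
have ui' : 0 < `|u 0 i| by rewrite normr_gt0.
pose y := r * (z / t / u 0 i).
have yE : `|y| = r * `|z| / `|u 0 i| / t.
  by rewrite /y !normrM !normfV (gtr0_norm r0) (gtr0_norm tp); field; rewrite !gt_eqF.
have yw : `|y| <= e * w.
  rewrite yE; apply: (@le_trans _ _ (r * `|z| / `|u 0 i| * (w * w))).
    by rewrite ww ler_wpM2l ?mulr_ge0 ?invr_ge0 ?(ltW r0).
  rewrite mulrA ler_wpM2r ?(ltW w0)//; apply: le_trans (ce1 ui).
  by rewrite mulrAC ler_wpM2r ?invr_ge0// -mulrA ler_wpM2l// ltW.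
have y2 : `|y| <= 2^-1 by have := normr_ge0 y; nra.
have yt : 2 * y ^+ 2 <= e / t.
  have yb : `|y| <= e / w / t.
    rewrite yE ler_wpM2r ?(ltW ti0)// ler_pdivlMr//.
    apply: le_trans (ce1 ui).
    by rewrite mulrAC ler_wpM2r ?invr_ge0// -mulrA ler_wpM2l// ltW.
  have e0 : 0 < e by lra.
  have : `|y| * `|y| <= (e / w / t) * (e * w) by apply: ler_pM.
  have -> : (e / w / t) * (e * w) = e * (e / t) by field; rewrite !gt_eqF.
  have : 0 < e / t by rewrite divr_gt0.
  by rewrite -(real_normK (num_real y)) expr2; nra.
apply: le_trans (powR_le_quadratic (ltW r1) ui y2) _.
have A : `|u 0 i| `^ r = dualvec r u 0 i * u 0 i by rewrite dualvec_mul// ltW.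
have A1 : `|u 0 i| `^ r <= 1.
  rewrite -(pnorm1_sum r0 u1) (bigD1 i)//= lerDl.
  by apply: sumr_ge0 => k _; exact: powR_ge0.
have A0 : 0 <= `|u 0 i| `^ r by exact: powR_ge0.
rewrite -/y mulrDr mulrDr mulr1; apply: lerD; last first.
  by have := sqr_ge0 y; nra.
rewrite lerD2l {1}A le_eqVlt; apply/orP; left; apply/eqP.
by rewrite /y; field; rewrite ui gt_eqF.
Qed.

(** The sphere is curved in the directions where u does not vanish, and flat of
order r in the other ones. *)
Lemma adapted_gt1 (R : realType) (d : nat) (r : R) (u : 'rV[R]_d) :
  1 < r -> pnorm r%:E u = 1 ->
  exists i0 beta f c, adapted r%:E u i0 beta f c /\
    kappa r%:E u = (\sum_i beta i)^-1.
Proof.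
move=> r1 u1; have p1 : (1 <= r%:E)%E by rewrite lee_fin ltW.
have r0 : 0 < r by lra.
have ri1 : r^-1 < 1 by rewrite invf_lt1.
have [i0 ui0] := pnorm_neq0_coord p1 u1.
pose beta i : R := if i == i0 then 1 else if u 0 i == 0 then 1 - r^-1 else 2^-1.
have fN v : linf (dualvec r u) v <= pnorm r%:E v by exact: linf_dualvec_le.
have fu : linf (dualvec r u) u = 1 by rewrite linf_dualvec ?(ltW r1)// pnorm1_sum.
exists i0, beta, (dualvec r u).
have [|i||i||c cP] :=
  @adapted_of_coord _ _ r%:E u i0 beta (dualvec r u) p1 ui0.
- by rewrite /beta eqxx.
- by rewrite /beta; case: ifP => // _; case: ifP => // _; rewrite subr_ge0 ltW.
- exact: fu.
- rewrite /beta; case: ifPn => [_|ii0]; first exact: low_widest.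
  case: ifPn => [/eqP ui|ui]; first exact: low_flat.
  exact: low_curved.
- have d0 : (0 < d%:R :> R) by rewrite ltr0n (leq_ltn_trans (leq0n _) (ltn_ord i0)).
  have d1 : (1 <= d%:R :> R) by rewrite ler1n (leq_ltn_trans (leq0n _) (ltn_ord i0)).
  pose e : R := (4 * d%:R)^-1.
  have e0 : 0 < e by rewrite invr_gt0 mulr_gt0.
  have e2 : e <= 2^-1 by rewrite lef_pV2 ?posrE//; [lra|rewrite mulr_gt0].
  have [c c0 cP] : exists2 c, 0 < c &
    forall i, c <= if u 0 i == 0 then e else Num.min e (e * `|u 0 i| / r).
    apply: exists_pos_lower_bound => i; case: eqP => [//|/eqP ui].
    by rewrite lt_min e0 divr_gt0// mulr_gt0// normr_gt0.
  have ce : c <= e.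
    by have := cP i0; rewrite (negbTE ui0) le_min => /andP[].
  exists c => // x v x01 h t0; set t := skew u i0 v i0 in t0.
  have tp : 0 < t.
    by apply: lt_le_trans t0; rewrite invr_gt0; case/andP: x01.
  have bd i : `|v 0 i| `^ r <= t `^ r *
    (`|u 0 i| `^ r + r * dualvec r u 0 i * (v 0 i / t - u 0 i) + e / t).
    apply: (@powR_coord_le _ _ r u v i0 i c x e) => //.
    - by rewrite c0; lra.
    - move=> ui; have := cP i; rewrite (negbTE ui) le_min => /andP[_].
      by rewrite ler_pdivlMr// ler_pdivrMr ?normr_gt0// mulrC.
    - by move=> ii0; have := h i ii0; rewrite /beta (negbTE ii0).
  pose X := r * (linf (dualvec r u) v / t - 1 + 4^-1 / t).
  have sX : \sum_i `|v 0 i| `^ r <= t `^ r * (1 + X / r * r).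
    apply: le_trans (ler_sum _ (fun i _ => bd i)) _.
    rewrite -mulr_sumr ler_wpM2l ?powR_ge0// !big_split/= (pnorm1_sum r0 u1).
    rewrite mulfVK ?gt_eqF// -addrA lerD2l /X.
    rewrite sumr_const card_ord -[_ *+ d]mulr_natr.
    have -> : e / t * d%:R = 4^-1 / t by rewrite /e; field; rewrite !gt_eqF.
    have -> : \sum_i r * dualvec r u 0 i * (v 0 i / t - u 0 i) =
        r * (linf (dualvec r u) v / t - 1).
      rewrite -[X in _ / t - X]fu /linf mulr_suml -sumrB mulr_sumr; apply: eq_bigr => i _.
      by ring.
    by rewrite [leRHS]mulrDr lerD2l ler_peMl ?(ltW r1)// divr_ge0// ltW.
  have X1 : 0 <= 1 + X.
    move: sX; rewrite mulfVK ?gt_eqF// => sX.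
    by have := le_trans (pnorm_fin_ge0 r v) sX; rewrite pmulr_rge0// powR_gt0.
  have N1 : pnorm r%:E v <= t * (1 + X) `^ r^-1.
    have -> : t = (t `^ r) `^ r^-1.
      by rewrite -powRrM mulfV ?gt_eqF// powRr1// ltW.
    rewrite -powRM ?powR_ge0//; apply: ge0_ler_powR => //.
    - by rewrite invr_ge0 ltW.
    - by rewrite nnegrE pnorm_fin_ge0.
    - by rewrite nnegrE mulr_ge0// powR_ge0.
    - by move: sX; rewrite mulfVK ?gt_eqF.
  have B : (1 + X) `^ r^-1 <= 1 + X / r.
    have [_ q1 rq] := conjugate_exponent r1 erefl; set q := r / (r - 1) in q1 rq.
    have := @conjugate_powR R ((1 + X) `^ r^-1) 1 r q (powR_ge0 _ _) ler01 r0
      (lt_trans ltr01 q1) rq.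
    rewrite mulr1 -powRrM mulVf ?gt_eqF// powRr1// powR1 => /le_trans; apply.
    by rewrite mulrDl !mul1r addrAC rq.
  apply: le_trans N1 _; apply: le_trans (ler_wpM2l (ltW tp) B) _.
  rewrite le_eqVlt; apply/orP; left; apply/eqP.
  by rewrite /X; field; rewrite !gt_eqF.
- exists c; split => //; rewrite /kappa gt_eqF//; congr (_ ^-1).
  have E : \sum_i beta i = \sum_(i < d) ((i == i0)%:R * 2^-1 +
      ((u 0 i != 0)%:R * 2^-1 + (1 - (u 0 i != 0)%:R) * (1 - r^-1))) :> R.
    apply: eq_bigr => i _; rewrite /beta.
    have [->|ii0] := eqVneq i i0; first by rewrite ui0 /=; field; rewrite gt_eqF.
    by case: eqP => _ /=; field; rewrite gt_eqF.
  rewrite E !big_split/= -!mulr_suml sumrB sumr_const card_ord !sum_bool_card.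
  have -> : [set i | i == i0]%SET = [set i0]%SET.
    by apply/setP => i; rewrite !inE.
  rewrite cards1 /d2 -/(d1 u).
  have dd : (d1 u <= d)%N by rewrite /d1 -[leqRHS]card_ord max_card.
  by rewrite natrB//; field; rewrite gt_eqF.
Qed.

Theorem exists_adapted (R : realType) (d : nat) (p : \bar R) (u : 'rV[R]_d) :
  (1 <= p)%E -> pnorm p u = 1 ->
  exists i0 beta f c, adapted p u i0 beta f c /\
    kappa p u = (\sum_i beta i)^-1.
Proof.
case: p => [r||]// p1 u1; last exact: adapted_infty.
move: p1; rewrite lee_fin le_eqVlt => /predU1P[r1|r1]; last exact: adapted_gt1.
by rewrite -r1 in u1 *; exact: adapted_one.
Qed.

(** * Volume of bricks *)

Definition brick (R : realType) (d : nat) (A : 'I_d -> set R) : set 'rV[R]_d :=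
  [set v | forall i, A i (v 0 i)].

Lemma lebesgue_rV_set0 (R : realType) (d : nat) :
  lebesgue_rV (set0 : set 'rV[R]_d) = 0%E.
Proof.
elim: d => [|d IH] /=; first by rewrite indicE in_set0.
rewrite [X in integral _ _ X](_ : _ = cst 0%E) ?integral0//.
by apply/funext => t /=; rewrite -[RHS]IH; congr lebesgue_rV.
Qed.

Lemma row_mx_const0 (R : realType) (d : nat) (t : R) (v : 'rV[R]_d) :
  (row_mx (const_mx t : 'rV_1) v : 'rV[R]_d.+1) 0 ord0 = t.
Proof.
transitivity ((const_mx t : 'rV[R]_1) 0 0); last by rewrite mxE.
rewrite -(row_mxEl (const_mx t : 'rV_1) v 0 0).
by congr (fun_of_matrix _ _ _); apply/val_inj.
Qed.

Lemma row_mx_const_lift (R : realType) (d : nat) (t : R) (v : 'rV[R]_d) j :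
  (row_mx (const_mx t : 'rV_1) v : 'rV[R]_d.+1) 0 (lift ord0 j) = v 0 j.
Proof.
rewrite -[RHS](row_mxEr (const_mx t : 'rV_1) v 0 j).
by congr (fun_of_matrix _ _ _); apply/val_inj.
Qed.

Lemma lebesgue_rV_brick (R : realType) (d : nat) (A : 'I_d -> set R)
    (l : 'I_d -> R) : (forall i, measurable (A i)) ->
  (forall i, lebesgue_measure (A i) = (l i)%:E) ->
  lebesgue_rV (brick A) = (\prod_i l i)%:E.
Proof.
elim: d A l => [|d IH] A l mA lA /=.
  rewrite big_ord0 indicE mem_set//.
  by case.
have l0 i : 0 <= l i by rewrite -lee_fin -lA measure_ge0.
have E t : lebesgue_rV [set v : 'rV[R]_d |
     brick A (row_mx (const_mx t : 'rV_1) v)] =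
    ((\prod_(i < d) l (lift ord0 i))%:E * (\1_(A ord0) t)%:E)%E.
  rewrite indicE; have [At|At] := pselect (A ord0 t).
    rewrite mem_set// mule1 -(IH (fun i => A (lift ord0 i)))//.
    congr lebesgue_rV; apply/seteqP; split => v /= h.
      by move=> i; have := h (lift ord0 i); rewrite row_mx_const_lift.
    move=> i; have [j ->|->] := unliftP ord0 i; rewrite ?row_mx_const0//.
    by rewrite row_mx_const_lift.
  rewrite memNset// mule0 -(lebesgue_rV_set0 R d); congr lebesgue_rV.
  by rewrite -subset0 => v /= /(_ ord0); rewrite row_mx_const0.
rewrite [X in integral _ _ X](_ : _ = fun t =>
    ((\prod_(i < d) l (lift ord0 i))%:E * (\1_(A ord0) t)%:E)%E); last first.
  by apply/funext => t; exact: E.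
rewrite ge0_integralZl//=; last 2 first.
- by apply: measurableT_comp => //; apply: measurable_indic; exact: mA.
- by rewrite lee_fin prodr_ge0.
rewrite integral_indic//; last exact: mA.
by rewrite setIT big_ord_recl mulrC EFinM; congr (_ * _)%E; exact: lA.
Qed.

Lemma borel_coord (R : realType) (d : nat) (i : 'I_d) (A : set R) :
  measurable A -> borel [set v : 'rV[R]_d | A (v 0 i)].
Proof.
move=> mA.
pose f (v : g_sigma_algebraType (@open 'rV[R]_d)) : R := v 0 i.
have mf : measurable_fun setT f.
  apply: (measurability _ (RGenOInfty.measurableE R)).
  move=> _ [_ [x ->] <-]; rewrite setTI.
  apply: sub_sigma_algebra.
  have : open ((fun v : 'rV[R]_d => v 0 i) @^-1` `]x, +oo[%classic).
    apply: open_comp => [v _|]; first exact: coord_continuous.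
    exact: interval_open.
  by [].
by have := mf measurableT A mA; rewrite setTI.
Qed.

Lemma borel_brick (R : realType) (d : nat) (A : 'I_d -> set R) :
  (forall i, measurable (A i)) -> borel (brick A).
Proof.
move=> mA.
have -> : brick A = \bigcap_(i in [set: 'I_d]) [set v : 'rV[R]_d | A i (v 0 i)].
  by apply/seteqP; split => v /= h i; [move=> _; exact: h|exact: h].
have := @fin_bigcap_measurable _ (g_sigma_algebraType (@open 'rV[R]_d)) 'I_d
  [set: 'I_d] (fun i => [set v | A i (v 0 i)]).
by apply => // i _; exact: borel_coord.
Qed.

(** The side m may be negative, as may the coordinate of u along which the slabs
are stacked. *)
Definition strip (R : realType) (b m : R) (k : int) : set R :=
  [set r | Num.floor ((r - b) / m) = k].

Lemma floorP (R : realType) (x : R) (k : int) :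
  Num.floor x = k <-> k%:~R <= x < (k + 1)%:~R.
Proof. by split => [<-|/floor_def//]; exact: floor_itv. Qed.

Lemma stripE (R : realType) (b m : R) (k : int) : m != 0 ->
  strip b m k = if 0 < m then `[b + m * k%:~R, b + m * k%:~R + m[%classic
                else `]b + m * k%:~R + m, b + m * k%:~R]%classic.
Proof.
move=> m0; apply/seteqP; split => r; rewrite /strip/=.
  move=> /floorP; rewrite intrD1; case: ifPn => mp.
    by rewrite ler_pdivlMr// ltr_pdivrMr//= in_itv/= => /andP[? ?]; apply/andP; split; lra.
  have mn : m < 0 by rewrite lt_neqAle m0 leNgt.
  by rewrite ler_ndivlMr// ltr_ndivrMr//= in_itv/= => /andP[? ?]; apply/andP; split; lra.
case: ifPn => mp /=; rewrite in_itv/= => /andP[h1 h2]; apply/floorP; rewrite intrD1.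
  by rewrite ler_pdivlMr// ltr_pdivrMr//; apply/andP; split; lra.
have mn : m < 0 by rewrite lt_neqAle m0 leNgt.
by rewrite ler_ndivlMr// ltr_ndivrMr//; apply/andP; split; lra.
Qed.

Lemma measurable_strip (R : realType) (b m : R) (k : int) : m != 0 ->
  measurable (strip b m k).
Proof. by move=> m0; rewrite stripE//; case: ifP => _; exact: measurable_itv. Qed.

Lemma lebesgue_strip (R : realType) (b m : R) (k : int) : m != 0 ->
  lebesgue_measure (strip b m k) = (`|m|)%:E.
Proof.
move=> m0; rewrite stripE//; case: ifPn => mp; rewrite lebesgue_measure_itv/= lte_fin.
  by rewrite ltrDl mp -EFinB addrC addKr gtr0_norm.
have mn : m < 0 by rewrite lt_neqAle m0 leNgt.
by rewrite gtrDl mn -EFinB opprD addNKr ltr0_norm.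
Qed.

(** * Poisson counts in disjoint cells *)

(** The remainder is l ^+ m times a series that is dominated term by term by that
of the exponential. *)
Lemma expR_tail (R : realType) (l : R) m : 0 <= l ->
  expR l - \sum_(j < m) l ^+ j / j`!%:R <= l ^+ m * expR l.
Proof.
move=> l0.
have part n : \sum_(j < n) l ^+ j / j`!%:R = series (exp_coeff l) n.
  by rewrite /series/= big_mkord.
have nd : nondecreasing_seq (series (exp_coeff l)).
  by apply: nondecreasing_series => n _ _; rewrite /exp_coeff/= mulr_ge0// exprn_ge0.
have le_exp n : series (exp_coeff l) n <= expR l.
  exact: (nondecreasing_cvgn_le nd (is_cvg_series_exp_coeff l)).
rewrite lerBlDr; apply: limr_le; first exact: is_cvg_series_exp_coeff.
exists m => // n /= mn.
rewrite -part -(subnKC mn) big_split_ord/= addrC lerD2r.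
apply: le_trans (ler_wpM2l (exprn_ge0 m l0) (le_exp (n - m)%N)).
rewrite -part mulr_sumr; apply: ler_sum => j _.
rewrite exprD -mulrA ler_wpM2l ?exprn_ge0// ler_wpM2l ?exprn_ge0//.
rewrite lef_pV2 ?posrE ?ltr0n ?fact_gt0// ler_nat.
elim: (m) (nat_of_ord j) => [|k IH] {}j; first by rewrite add0n.
by rewrite addSn factS (leq_trans (IH j))// leq_pmull.
Qed.

Section poisson_cells.
Context (R : realType) (d : nat) (disp : measure_display)
  (T : measurableType disp) (P : probability T R) (Xi : T -> set 'rV[R]_d).
Hypothesis PP : poisson_process P Xi.

Lemma measurable_count_preimage B (A : set (\bar R)) : borel B -> measurable A ->
  measurable (point_count Xi B @^-1` A).
Proof.
by move=> bB mA; have := pp_measurable PP bB measurableT mA; rewrite setTI.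
Qed.

Lemma measurable_count_ge B (x : \bar R) : borel B ->
  measurable [set w | (x <= point_count Xi B w)%E].
Proof.
move=> bB; have := @measurable_count_preimage B `[x, +oo%E]%classic bB.
move=> /(_ (emeasurable_itv _)); congr measurable.
by apply/seteqP; split => w /=; rewrite in_itv/= ?leey ?andbT.
Qed.

Lemma measurable_count_eq B (x : \bar R) : borel B ->
  measurable [set w | point_count Xi B w = x].
Proof.
by move=> bB; exact: (@measurable_count_preimage B [set x] bB (emeasurable_set1 _)).
Qed.

Lemma count_eq_prob B (l : R) k : borel B -> lebesgue_rV B = l%:E -> 0 < l ->
  P [set w | point_count Xi B w = k%:R%:E] =
    (l ^+ k / k`!%:R * expR (- l))%:E.
Proof.
move=> bB lB l0; rewrite (pp_poisson PP)// ?lB ?ltry//=.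
by rewrite /poisson_prob l0 esum_set1 ?lee_fin ?poisson_pmf_ge0// /poisson_pmf l0.
Qed.

(** The factorial is given up, so that the bound is multiplicative in m. *)
Lemma count_ge_prob B (l : R) m : borel B -> lebesgue_rV B = l%:E -> 0 < l ->
  (P [set w | (m%:R%:E <= point_count Xi B w)%E] <= (l ^+ m)%:E)%E.
Proof.
move=> bB lB l0.
suff H : (P [set w | (m%:R%:E <= point_count Xi B w)%E] <=
    (1 - expR (- l) * \sum_(j < m) l ^+ j / j`!%:R)%:E)%E.
  apply: le_trans H _; rewrite lee_fin.
  have := expR_tail m (ltW l0); rewrite -(ler_pM2l (expR_gt0 (- l))) mulrBr.
  by rewrite mulrCA (mulrC (expR (- l)) (expR l)) expRxMexpNx_1 mulr1.
elim: m => [|m IH].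
  by rewrite big_ord0 mulr0 subr0; exact: probability_le1 (measurable_count_ge _ bB).
set A := [set w | _] in IH *; set A' := [set w | _] in IH *.
have mA := measurable_count_ge m.+1%:R%:E bB.
have mE := measurable_count_eq m%:R%:E bB.
have : (P A' + P [set w | point_count Xi B w = m%:R%:E] <= P A)%E.
  rewrite -measureU//; last first.
    rewrite -subset0 => w /= [h e]; move: h.
    by rewrite /A'/= e lee_fin ler_nat ltnn.
  apply: le_measure; rewrite ?inE.
  - exact: measurableU.
  - exact: measurable_count_ge.
  - move=> w [|] /=; rewrite /A /A'/=; last by move=> ->.
    by apply: le_trans; rewrite lee_fin ler_nat.
rewrite (count_eq_prob m bB lB l0) big_ord_recr/= mulrDr opprD addrA => h.
rewrite EFinB leeBrDr// (mulrC (expR _) (_ / _)).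
exact: le_trans h IH.
Qed.

Context (K : eqType) (cell : 'rV[R]_d -> K) (l : R).
Hypothesis bcell : forall k, borel [set v | cell v = k].
Hypothesis lcell : forall k, lebesgue_rV [set v | cell v = k] = l%:E.
Hypothesis l0 : 0 < l.

(** The cells of a sequence of distinct points, listed with repetitions, contain
at least as many points as they have occurrences. *)
Definition crowded (ks : seq K) : set T :=
  [set w | forall q, q \in ks ->
    ((count_mem q ks)%:R%:E <= point_count Xi [set v | cell v = q] w)%E].

Lemma prob_cells (ks : seq K) (A : K -> set (\bar R)) : uniq ks ->
  (forall k, measurable (A k)) ->
  measurable [set w | forall q, q \in ks -> A q (point_count Xi [set v | cell v = q] w)] /\
  P [set w | forall q, q \in ks -> A q (point_count Xi [set v | cell v = q] w)] =
    (\prod_(q <- ks) P (point_count Xi [set v | cell v = q] @^-1` A q))%E.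
Proof.
move=> uks mA.
pose t := in_tuple ks; pose B (i : 'I_(size ks)) := [set v | cell v = tnth t i].
have E : [set w | forall q, q \in ks ->
      A q (point_count Xi [set v | cell v = q] w)] =
    \bigcap_i (point_count Xi (B i) @^-1` A (tnth t i)).
  apply/seteqP; split => w /= h.
    by move=> i _; apply: h; exact: mem_tnth.
  by move=> q /(tnthP t)[i ->]; exact: h.
rewrite E; split.
  apply: fin_bigcap_measurable => // i _.
  by apply: measurable_count_preimage => //; exact: bcell.
rewrite (pp_independent PP (B := B))//; last 2 first.
- by move=> i; exact: bcell.
- apply/trivIsetP => i j _ _ ij; rewrite -subset0 => v /= [h1 h2].
  by move/eqP: ij; apply; apply: (tuple_uniqP t uks); rewrite -h1 -h2.
by rewrite [RHS]big_tnth.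
Qed.

Lemma crowdedE ks : crowded ks = [set w | forall q, q \in undup ks ->
    `[(count_mem q ks)%:R%:E, +oo%E]%classic
       (point_count Xi [set v | cell v = q] w)].
Proof.
apply/seteqP; split => w h q /= qks.
  by rewrite in_itv/= leey andbT; apply: h; rewrite -mem_undup.
by have := h q; rewrite mem_undup => /(_ qks) /=; rewrite in_itv/= leey andbT.
Qed.

Lemma measurable_crowded ks : measurable (crowded ks).
Proof.
rewrite crowdedE.
by apply: (@prob_cells (undup ks) (fun q => _) (undup_uniq ks) _).1 => k; exact: emeasurable_itv.
Qed.

(** Distinct cells are independent, and the multiplicities add up to the length of
the sequence. *)
Lemma crowded_prob ks : (P (crowded ks) <= (l ^+ size ks)%:E)%E.
Proof.
rewrite crowdedE (@prob_cells (undup ks) (fun q => _) (undup_uniq ks) _).2; last first.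
  by move=> k; exact: emeasurable_itv.
apply: (@le_trans _ _ (\prod_(q <- undup ks) (l ^+ count_mem q ks)%:E)%E).
  elim: (undup ks) => [|q s IH]; first by rewrite !big_nil.
  rewrite !big_cons; apply: lee_pmul => //.
  - by elim/big_ind: _ => // x y x0 y0; exact: mule_ge0.
  - have := count_ge_prob (count_mem q ks) (bcell q) (lcell q) l0.
    apply: le_trans; rewrite le_eqVlt; apply/orP; left; apply/eqP; congr (P _).
    by apply/seteqP; split => w /=; rewrite in_itv/= leey andbT.
have -> : l ^+ size ks = \prod_(q <- ks) l.
  by rewrite big_const_seq count_predT iter_mulr_1.
by rewrite prodEFin lee_fin -[leRHS](big_undup_iterop_count _ ks xpredT (fun=> l)).
Qed.

Lemma all_empty_prob ks : uniq ks ->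
  measurable [set w | forall q, q \in ks -> point_count Xi [set v | cell v = q] w = 0%E] /\
  P [set w | forall q, q \in ks -> point_count Xi [set v | cell v = q] w = 0%E] =
    (expR (- ((size ks)%:R * l)))%:E.
Proof.
move=> uks; have [|mE ->] := @prob_cells ks (fun=> [set 0%E]) uks.
  by move=> _; exact: emeasurable_set1.
split => //.
under eq_bigr => q _ do
  rewrite (count_eq_prob 0 (bcell q) (lcell q) l0) expr0 fact0 invr1 !mul1r.
by rewrite prodEFin big_const_seq count_predT iter_mulr_1 -expRM_natl mulrN.
Qed.

Lemma counting_ge_size (X : set 'rV[R]_d) (s : seq 'rV[R]_d) : uniq s ->
  {in s, forall c, X c} -> ((size s)%:R%:E <= counting X :> \bar R)%E.
Proof.
move=> us sX; rewrite /counting; case: asboolP => [fX|_]; last by rewrite leey.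
rewrite lee_fin ler_nat; apply: uniq_leq_size => // c cs.
by rewrite in_fset_set// inE; exact: sX.
Qed.

Lemma crowded_points w (cs : seq 'rV[R]_d) : uniq cs ->
  {in cs, forall c, Xi w c} -> crowded (map cell cs) w.
Proof.
move=> ucs csX q _.
rewrite count_map -size_filter; apply: counting_ge_size; first exact: filter_uniq.
by move=> c; rewrite mem_filter => /andP[/eqP /= <- /csX].
Qed.

End poisson_cells.

(** * From paths to chains of balls *)

(** A step gets delta for free: the radius of a ball at each of its ends. *)
Fixpoint chain (R : realType) (d : nat) (p : \bar R) (delta : R)
    (x : 'rV[R]_d) (cs : seq 'rV[R]_d) : R :=
  if cs is c :: cs' then
    Num.max 0 (pnorm p (c - x) - delta) + chain p delta c cs'
  else 0.

Section chains.
Context (R : realType) (d : nat) (p : \bar R) (delta : R).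
Hypothesis p1 : (1 <= p)%E.
Local Notation N := (pnorm p).
Local Notation chain := (chain p delta).
Implicit Types (x y c q v : 'rV[R]_d) (cs : seq 'rV[R]_d).

Lemma chain_ge0 x cs : 0 <= chain x cs.
Proof. by elim: cs x => //= c cs IH x; rewrite addr_ge0// le_max lexx. Qed.

Lemma chain_cat x cs cs' : chain x (cs ++ cs') = chain x cs + chain (last x cs) cs'.
Proof. by elim: cs x => [|c cs IH] x /=; rewrite ?add0r// IH addrA. Qed.

(** Steps have nonnegative cost, so that loops can be cut. *)
Lemma loop_erasure x y cs : exists cs', [/\ uniq cs', {subset cs' <= cs} &
  chain x (rcons cs' y) <= chain x (rcons cs y)].
Proof.
have [n] := ubnP (size cs); elim: n x cs => // n IH x [|c cs] /=.
  by move=> _; exists [::].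
rewrite ltnS => sn; have [ccs|ccs] := boolP (c \in cs).
  case/splitPr: ccs sn => a b; rewrite size_cat/= => sn.
  have [|cs' [ucs' scs' le]] := IH x (c :: b).
    by apply: leq_trans sn; rewrite ltnS leq_addl.
  exists cs'; split => //.
    move=> z /scs'; rewrite !inE mem_cat inE.
    by move=> /orP[->|->]; rewrite ?orbT.
  apply: le_trans le _; rewrite /= lerD2l rcons_cat chain_cat/= addrA lerDr.
  by rewrite addr_ge0 ?chain_ge0// le_max lexx.
have [cs' [ucs' scs' le]] := IH c cs sn.
exists (c :: cs'); split => /=.
- by rewrite ucs' andbT; apply: contra ccs; exact: scs'.
- by move=> z; rewrite !inE => /orP[->//|/scs' ->]; rewrite orbT.
- by rewrite lerD2l.
Qed.

Context (X : set 'rV[R]_d).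
Hypothesis delta0 : 0 <= delta.

(** A chain of balls followed by a last step, which is charged from the boundary
of the last ball on; the origin plays the part of the centre of a first ball. *)
Definition reach (tau : R) q := exists cs, {in cs, forall c, X c} /\
  chain 0 cs + Num.max 0 (N (q - last 0 cs) - delta / 2) <= tau.

Lemma reach0 : reach 0 0.
Proof.
exists [::]; split => //=; rewrite add0r subr0 pnorm0// sub0r.
by rewrite ge_max lexx/= oppr_le0 divr_ge0.
Qed.

Lemma reach_le tau tau' q : tau <= tau' -> reach tau q -> reach tau' q.
Proof. by move=> tt [cs [csX h]]; exists cs; split => //; exact: le_trans tt. Qed.

Lemma reach_move tau q q' : reach tau q -> reach (tau + N (q' - q)) q'.
Proof.
move=> [cs [csX h]]; exists cs; split => //.
have := ler_pnormD (q' - q) (q - last 0 cs) p1; rewrite addrA subrK => t.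
have n0 := pnorm_ge0 p (q' - q).
have : Num.max 0 (N (q' - last 0 cs) - delta / 2) <=
    Num.max 0 (N (q - last 0 cs) - delta / 2) + N (q' - q).
  rewrite ge_max; apply/andP; split; first by rewrite addr_ge0// le_max lexx.
  have : N (q - last 0 cs) - delta / 2 <= Num.max 0 (N (q - last 0 cs) - delta / 2).
    by rewrite le_max lexx orbT.
  by lra.
by lra.
Qed.

(** No time is spent inside a ball: its centre can be added to the chain. *)
Lemma reach_ball tau q q' c : X c -> N (q - c) <= delta / 2 ->
  N (q' - c) <= delta / 2 -> reach tau q -> reach tau q'.
Proof.
move=> Xc qc q'c [cs [csX h]]; exists (rcons cs c); split.
  by move=> z; rewrite mem_rcons inE => /orP[/eqP ->//|/csX].
rewrite -cats1 chain_cat /= addr0 last_cat/=.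
have -> : Num.max 0 (N (q' - c) - delta / 2) = 0 by apply/max_idPl; lra.
rewrite addr0; apply: le_trans h; rewrite lerD2l ge_max le_max lexx/=.
rewrite le_max; apply/orP; right.
have := ler_pnormD (c - q) (q - last 0 cs) p1; rewrite addrA subrK.
by rewrite (pnorm_subC _ q)//; lra.
Qed.

Definition outside x v (L : seq 'rV[R]_d) (a b : R) : set R :=
  [set t | a <= t <= b /\ {in L, forall c, delta / 2 < N (x + t *: v - c)}].

Lemma pnorm_line_lip x v c (s t : R) :
  N (x + s *: v - c) <= N (x + t *: v - c) + `|s - t| * N v.
Proof.
rewrite -pnormZ//; apply: le_trans (ler_pnormD _ _ p1).
by rewrite le_eqVlt; apply/orP; left; apply/eqP; congr pnorm;
  apply/rowP => i; rewrite !mxE; ring.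
Qed.

Lemma measurable_outside x v L a b : measurable (outside x v L a b).
Proof.
have -> : outside x v L a b = `[a, b]%classic `&`
    \bigcap_(i in [set: 'I_(size L)]) [set t | delta / 2 < N (x + t *: v - L`_i)].
  apply/seteqP; split => t /=; rewrite in_itv/=.
    by move=> [-> h]; split => // i _; apply: h; exact: mem_nth.
  move=> [tab h]; split => // c cL.
  by have := h (Ordinal (etrans (index_mem c L) cL)) I; rewrite /= nth_index.
apply: measurableI; first exact: measurable_itv.
apply: fin_bigcap_measurable => // i _; apply: open_measurable.
have -> : [set t | delta / 2 < N (x + t *: v - L`_i)] =
    (fun t : R => N (x + t *: v - L`_i)) @^-1` `]delta / 2, +oo[%classic.
  by apply/seteqP; split => t /=; rewrite in_itv/= andbT.
apply: open_comp.
  move=> t _; apply/cvgrPdist_lt => e e0.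
  have k0 : 0 < e / (1 + N v) by rewrite divr_gt0//; have := pnorm_ge0 p v; lra.
  near=> s.
  have st : `|t - s| < e / (1 + N v) by near: s; exact: cvgr_dist_lt.
  have : `|t - s| * (1 + N v) < e.
    by rewrite -ltr_pdivlMr//; have := pnorm_ge0 p v; lra.
  have := pnorm_line_lip x v L`_i s t; have := pnorm_line_lip x v L`_i t s.
  rewrite (distrC s) ltr_norml mulrDr mulr1; have := normr_ge0 (t - s).
  have := pnorm_ge0 p v.
  by move=> *; apply/andP; split; lra.
exact: interval_open.
Unshelve. all: by end_near. Qed.

Lemma outside_fin x v L a b : lebesgue_measure (outside x v L a b) \is a fin_num.
Proof.
rewrite ge0_fin_numE ?measure_ge0//.
apply: (@le_lt_trans _ _ (lebesgue_measure `[a, b]%classic)).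
  apply: le_measure; rewrite ?inE; [exact: measurable_outside|exact: measurable_itv|].
  by move=> t [].
by rewrite lebesgue_measure_itv/= lte_fin; case: ifP => _; rewrite ?ltry// -EFinB ltry.
Qed.

(** By induction on the balls that may meet the segment. One that does is crossed
for free from its first to its last point on the segment, and the rest of the
segment avoids it. *)
Lemma reach_segment x v L (a b tau : R) : {in L, forall c, X c} -> a <= b ->
  reach tau (x + a *: v) ->
  reach (tau + N v * fine (lebesgue_measure (outside x v L a b))) (x + b *: v).
Proof.
elim: L a b tau => [|c L IH] a b tau LX ab h.
  have -> : outside x v [::] a b = `[a, b]%classic.
    by apply/seteqP; split => t /=; rewrite in_itv/=; [move=> []|split].
  have := reach_move (x + b *: v) h; congr (reach (_ + _) _).
  have -> : x + b *: v - (x + a *: v) = (b - a) *: v.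
    by apply/rowP => i; rewrite !mxE; ring.
  rewrite pnormZ// lebesgue_measure_itv/= lte_fin ger0_norm ?subr_ge0//.
  move: ab; rewrite le_eqVlt => /predU1P[->|ab].
    by rewrite subrr ltxx mul0r mulr0.
  by rewrite ab mulrC.
have LX' : {in L, forall c, X c} by move=> z zL; apply: LX; rewrite inE zL orbT.
have Xc : X c by apply: LX; rewrite inE eqxx.
pose S := [set t : R | a <= t <= b /\ N (x + t *: v - c) <= delta / 2].
have [S0|/set0P S0] := eqVneq S set0.
  have -> : outside x v (c :: L) a b = outside x v L a b.
    apply/seteqP; split => t /= [tab tL]; split => // z zL.
      by apply: tL; rewrite inE zL orbT.
    move: zL; rewrite inE => /orP[/eqP ->|/tL//].
    rewrite ltNge; apply/negP => ?; suff : S t by rewrite S0.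
    by split.
  exact: IH.
have lS : has_lbound S by exists a => t [/andP[]].
have uS : has_ubound S by exists b => t [/andP[]].
pose t1 := inf S; pose t2 := sup S.
have [t0 St0] := S0.
have adh t : (forall e, 0 < e -> exists2 s, S s & `|t - s| < e) ->
    N (x + t *: v - c) <= delta / 2.
  move=> H; apply/ler_addgt0Pr => e e0.
  have k0 : 0 < e / (1 + N v) by rewrite divr_gt0//; have := pnorm_ge0 p v; lra.
  have [s [_ Ss] ts] := H _ k0.
  have : `|t - s| * (1 + N v) < e.
    by rewrite -ltr_pdivlMr//; have := pnorm_ge0 p v; lra.
  have := pnorm_line_lip x v c t s; rewrite mulrDr mulr1.
  by have := normr_ge0 (t - s); lra.
have B1 : N (x + t1 *: v - c) <= delta / 2.
  apply: adh => e e0; have [s Ss se] := inf_adherent e0 (conj S0 lS).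
  exists s => //; have := ge_inf lS Ss; rewrite -/t1 distrC => ts.
  by rewrite ger0_norm ?subr_ge0// ltrBlDl.
have B2 : N (x + t2 *: v - c) <= delta / 2.
  apply: adh => e e0; have [s Ss se] := sup_adherent e0 (conj S0 uS).
  exists s => //; have := ub_le_sup uS Ss; rewrite -/t2 => ts.
  by rewrite ger0_norm ?subr_ge0//; move: se; rewrite -/t2; lra.
have at1 : a <= t1 by apply: lb_le_inf => // t [/andP[]].
have t2b : t2 <= b by apply: ge_sup => // t [/andP[]].
have t12 : t1 <= t2 by apply: le_trans (ge_inf lS St0) (ub_le_sup uS St0).
have {}h := reach_ball Xc B1 B2 (IH _ _ _ LX' at1 h).
have {}h := IH _ _ _ LX' t2b h.
apply: reach_le h; rewrite -addrA lerD2l -mulrDr ler_wpM2l ?pnorm_ge0//.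
rewrite -fineD ?outside_fin//; apply: fine_le; rewrite ?fin_numD ?outside_fin//.
(* Without their common end points with the ball, the two remaining pieces
   avoid it; a point has no length. *)
have drop M (mM : measurable M) (t : R) :
    (lebesgue_measure M <= lebesgue_measure (M `\ t))%E.
  apply: (@le_trans _ _ (lebesgue_measure ((M `\ t) `|` [set t]))).
    apply: le_measure; rewrite ?inE//.
      by apply: measurableU => //; apply: measurableD.
    by move=> s Ms; have [->|/eqP tt] := eqVneq s t; [right|left].
  rewrite measureU//; last 2 first.
  - exact: measurableD.
  - by rewrite -subset0 => s [[]].
  rewrite [X in (_ + X)%E](_ : _ = 0%E) ?adde0//.
  exact: lebesgue_measure_set1.
apply: le_trans (leeD (drop _ (measurable_outside _ _ _ _ _) t1)
                      (drop _ (measurable_outside _ _ _ _ _) t2)) _.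
rewrite -measureU//; last 3 first.
- by apply: measurableD => //; exact: measurable_outside.
- by apply: measurableD => //; exact: measurable_outside.
- rewrite -subset0 => t [[[/andP[_ h1] _] n1] [[/andP[h2 _] _] n2]].
  by apply: n1 => /=; apply/eqP; rewrite eq_le h1 (le_trans t12).
apply: le_measure; rewrite ?inE.
- by apply: measurableU; apply: measurableD => //; exact: measurable_outside.
- exact: measurable_outside.
move=> t [[[/andP[h1 h2] tL] n1]|[[/andP[h1 h2] tL] n2]].
  have tt : t < t1 by rewrite lt_neqAle h2 andbT; apply/eqP.
  have tab : a <= t <= b by rewrite h1 (le_trans h2)// (le_trans t12).
  split => // z; rewrite inE => /orP[/eqP ->|/tL//].
  rewrite ltNge; apply/negP => hz; have : S t by split.
  by move=> /(ge_inf lS); rewrite -/t1 leNgt tt.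
have tt : t2 < t by rewrite lt_neqAle h1 andbT eq_sym; apply/eqP.
have tab : a <= t <= b by rewrite h2 andbT (le_trans at1)// (le_trans t12).
split => // z; rewrite inE => /orP[/eqP ->|/tL//].
rewrite ltNge; apply/negP => hz; have : S t by split.
by move=> /(ub_le_sup uS); rewrite -/t2 leNgt tt.
Qed.

End chains.

Lemma finite_near (R : realType) (d : nat) (p : \bar R) (X : set 'rV[R]_d)
    (x : 'rV[R]_d) (M : R) : (1 <= p)%E ->
  (forall K, compact K -> finite_set (X `&` K)) ->
  exists L : seq 'rV[R]_d, {in L, forall c, X c} /\
    (forall c, X c -> pnorm p (c - x) <= M -> c \in L).
Proof.
move=> p1 Xfin.
have := Xfin [set v : 'rV[R]_d | forall i,
  `[x 0 i - M, x 0 i + M]%classic (v ord0 i)].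
move=> /(_ (rV_compact (fun i => @segment_compact _ _ _))) fX.
exists (finmap.enum_fset (fset_set (X `&` [set v : 'rV[R]_d | forall i,
  `[x 0 i - M, x 0 i + M]%classic (v ord0 i)]))); split.
  by move=> c; rewrite in_fset_set// inE => -[].
move=> c Xc cM; rewrite in_fset_set// inE; split => //= i.
have := le_trans (ler_coord_pnorm (c - x) i p1) cM.
rewrite !mxE in_itv/= ler_norml => /andP[h1 h2].
by apply/andP; split; lra.
Qed.

(** Only the finitely many balls near a segment matter. *)
Lemma plength_outside (R : realType) (d : nat) (p : \bar R) (eps : R)
    (X : set 'rV[R]_d) (x y : 'rV[R]_d) :
  (1 <= p)%E -> (forall K, compact K -> finite_set (X `&` K)) ->
  exists L : seq 'rV[R]_d, [/\ {in L, forall c, X c}, (X x -> x \in L) &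
    plength p x y (~` Sigma p eps X) = pnorm p (y - x) *
      fine (lebesgue_measure (outside p (eps `^ d%:R^-1) x (y - x) L 0 1))].
Proof.
move=> p1 Xfin; set delta := eps `^ _; pose v := y - x.
have delta0 : 0 <= delta by exact: powR_ge0.
have [L [LX Lall]] := finite_near x (pnorm p v + delta / 2) p1 Xfin.
exists L; split => //.
  by move=> Xx; apply: Lall => //; rewrite subrr pnorm0// addr_ge0 ?pnorm_ge0// divr_ge0.
rewrite /plength; congr (_ * fine (lebesgue_measure _)).
apply/seteqP; split => t /= [t01 ht]; split => //.
  move=> c cL; rewrite ltNge; apply/negP => hc; apply: ht.
  by exists c => //; exact: LX.
move=> [c Xc hc]; suff cL : c \in L.
  by have := ht c cL; rewrite ltNge => /negP; apply; exact: hc.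
apply: Lall => //; move: hc; rewrite /pball/= -/delta => hc.
have := ler_pnormD (c - (x + t *: v)) (t *: v) p1.
rewrite (pnorm_subC c)// pnormZ// ger0_norm; last by case/andP: t01.
have -> : c - (x + t *: v) + t *: v = c - x.
  by apply/rowP => i; rewrite !mxE; ring.
have : t * pnorm p v <= pnorm p v.
  by rewrite ler_piMl ?pnorm_ge0//; case/andP: t01.
by lra.
Qed.

Lemma plength_ge0 (R : realType) (d : nat) (p : \bar R) (x y : 'rV[R]_d) A :
  0 <= plength p x y A.
Proof. by rewrite mulr_ge0 ?pnorm_ge0// fine_ge0. Qed.

Lemma plength_le_pnorm (R : realType) (d : nat) (p : \bar R) (eps : R)
    (X : set 'rV[R]_d) (x y : 'rV[R]_d) :
  (1 <= p)%E -> (forall K, compact K -> finite_set (X `&` K)) ->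
  plength p x y (~` Sigma p eps X) <= pnorm p (y - x).
Proof.
move=> p1 Xfin; have [L [_ _ ->]] := plength_outside eps x y p1 Xfin.
rewrite ler_piMr ?pnorm_ge0// -lee_fin fineK ?outside_fin//.
apply: (@le_trans _ _ (lebesgue_measure `[0 : R, 1]%classic)).
  apply: le_measure; rewrite ?inE; [exact: measurable_outside|exact: measurable_itv|].
  by move=> t [].
by rewrite lebesgue_measure_itv/= lte_fin ltr01 -EFinB subr0.
Qed.

Lemma plength_le_center (R : realType) (d : nat) (p : \bar R) (eps : R)
    (X : set 'rV[R]_d) (x y : 'rV[R]_d) :
  (1 <= p)%E -> (forall K, compact K -> finite_set (X `&` K)) -> X x ->
  eps `^ d%:R^-1 / 2 <= pnorm p (y - x) -> 0 < pnorm p (y - x) ->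
  plength p x y (~` Sigma p eps X) <= pnorm p (y - x) - eps `^ d%:R^-1 / 2.
Proof.
move=> p1 Xfin Xx; have [L [_ /(_ Xx) xL ->]] := plength_outside eps x y p1 Xfin.
set delta := eps `^ _; set N := pnorm p (y - x) => dN N0.
suff H : fine (lebesgue_measure (outside p delta x (y - x) L 0 1)) <= 1 - delta / 2 / N.
  by apply: le_trans (ler_wpM2l (ltW N0) H) _; rewrite mulrBr mulr1 mulrCA mulfV ?gt_eqF// mulr1.
rewrite -lee_fin fineK ?outside_fin//.
apply: (@le_trans _ _ (lebesgue_measure `[delta / 2 / N, 1]%classic)).
  apply: le_measure; rewrite ?inE; [exact: measurable_outside|exact: measurable_itv|].
  move=> t [/andP[t0 t1] /(_ x xL)]; rewrite addrC addKr pnormZ// ger0_norm// => h.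
  by rewrite /= in_itv/= t1 andbT ler_pdivrMr// ltW.
rewrite lebesgue_measure_itv/= lte_fin; case: ifPn => // _.
by rewrite lee_fin subr_ge0 ler_pdivrMr// mul1r.
Qed.

Lemma reach_path (R : realType) (d : nat) (p : \bar R) (eps : R)
    (X : set 'rV[R]_d) (x y : 'rV[R]_d) (s : seq 'rV[R]_d) (tau : R) :
  (1 <= p)%E -> (forall K, compact K -> finite_set (X `&` K)) ->
  reach p (eps `^ d%:R^-1) X tau x ->
  reach p (eps `^ d%:R^-1) X (tau + path_time p eps X x y s) y.
Proof.
move=> p1 Xfin; set delta := eps `^ _.
have seg (x' y' : 'rV[R]_d) t' : reach p delta X t' x' ->
    reach p delta X (t' + plength p x' y' (~` Sigma p eps X)) y'.
  move=> h; have [L [LX _ ->]] := plength_outside eps x' y' p1 Xfin.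
  have := @reach_segment _ _ p delta p1 X x' (y' - x') L 0 1 t' LX ler01.
  by rewrite scale0r scale1r addr0 subrKC; apply.
elim: s x tau => [|z s IH] x tau h; rewrite /path_time/=.
  by rewrite big_cons big_nil addr0; exact: seg.
by rewrite big_cons addrA; apply: IH; exact: seg.
Qed.

(** The path is followed while a chain explains the time spent so far; the loops
of the chain are erased at the end to make its points distinct. *)
Theorem path_time_chain (R : realType) (d : nat) (p : \bar R) (eps : R)
    (X : set 'rV[R]_d) (y : 'rV[R]_d) (s : seq 'rV[R]_d) :
  (1 <= p)%E -> (forall K, compact K -> finite_set (X `&` K)) ->
  exists cs, [/\ uniq cs, {in cs, forall c, X c} &
    chain p (eps `^ d%:R^-1) 0 (rcons cs y) <= path_time p eps X 0 y s].
Proof.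
move=> p1 Xfin; have d0 : 0 <= eps `^ d%:R^-1 by exact: powR_ge0.
have [cs [csX h]] := reach_path y s p1 Xfin (reach0 p1 X d0).
have [cs' [ucs' scs' le]] := @loop_erasure R d p (eps `^ d%:R^-1) 0 y cs.
exists cs'; split => //; first by move=> c /scs'/csX.
apply: le_trans le _; move: h; rewrite add0r; apply: le_trans.
rewrite -cats1 chain_cat/= addr0 lerD2l ge_max le_max lexx/=.
by rewrite le_max; apply/orP; right; lra.
Qed.

(** * Skewed cells *)

Section cells.
Context (R : realType) (d : nat) (u : 'rV[R]_d) (i0 : 'I_d) (eta : R)
  (w : 'I_d -> R).
Hypotheses (ui0 : u 0 i0 != 0) (eta0 : 0 < eta) (w0 : forall i, 0 < w i).

(** The cells are axis-parallel bricks, so that their volume is a product. They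
are stacked in slabs of thickness eta in the coordinate i0, and shifted from one
slab to the next in order to follow u. *)
Definition cell (v : 'rV[R]_d) : {ffun 'I_d -> int} :=
  let k0 := Num.floor (v 0 i0 / (eta * u 0 i0)) in
  [ffun i => if i == i0 then k0
             else Num.floor ((v 0 i - u 0 i * (eta * k0%:~R)) / w i)].

Definition cell_side (i : 'I_d) : R := if i == i0 then eta * u 0 i0 else w i.

Lemma cell_side_neq0 i : cell_side i != 0.
Proof.
rewrite /cell_side; case: ifP => _; last by rewrite gt_eqF.
by rewrite mulf_neq0// gt_eqF.
Qed.

Lemma cell_brick (k : {ffun 'I_d -> int}) : [set v | cell v = k] =
  brick (fun i => strip (if i == i0 then 0 else u 0 i * (eta * (k i0)%:~R))
                        (cell_side i) (k i)).
Proof.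
apply/seteqP; split => v /=.
  move=> <- i; rewrite /strip/= /cell_side !ffunE eqxx.
  by case: eqP => [->|//]; rewrite subr0.
move=> h; apply/ffunP => i; rewrite ffunE.
have := h i0; rewrite /strip/= /cell_side eqxx subr0 => ->.
case: eqP => [->//|/eqP ii0].
by have := h i; rewrite /strip/= /cell_side (negbTE ii0).
Qed.

Lemma borel_cell k : borel [set v | cell v = k].
Proof.
rewrite cell_brick; apply: borel_brick => i.
exact: (measurable_strip _ _ (cell_side_neq0 i)).
Qed.

Definition cell_volume : R := eta * `|u 0 i0| * \prod_(i | i != i0) w i.

Lemma lebesgue_cell k : lebesgue_rV [set v | cell v = k] = cell_volume%:E.
Proof.
rewrite cell_brick (@lebesgue_rV_brick _ _ _ (fun i => `|cell_side i|)).
- rewrite (bigD1 i0)//= {1}/cell_side eqxx normrM gtr0_norm//.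
  congr ((_ * _)%:E); apply: eq_bigr => i ii0.
  by rewrite /cell_side (negbTE ii0) gtr0_norm.
- by move=> i; exact: (measurable_strip _ _ (cell_side_neq0 i)).
- by move=> i; exact: (lebesgue_strip _ _ (cell_side_neq0 i)).
Qed.

Lemma cell_volume_gt0 : 0 < cell_volume.
Proof. by rewrite !mulr_gt0 ?normr_gt0//; apply: prodr_gt0. Qed.

Lemma cell0 : cell 0 = 0.
Proof.
by apply/ffunP => i; rewrite !ffunE !mxE !mul0r floor0 mulr0 mulr0 subr0 mul0r
  floor0; case: ifP.
Qed.

Hypothesis etaw : forall i, i != i0 -> `|u 0 i| * eta <= w i.

Definition skew_side (i : 'I_d) : R := if i == i0 then eta else w i.

Lemma floor_dist (r : R) : `|r - (Num.floor r)%:~R| <= 1.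
Proof.
have /andP[h1 h2] := floor_itv r; move: h2; rewrite intrD1 => h2.
by rewrite ger0_norm ?subr_ge0//; lra.
Qed.

(** Within a slab the line of u drifts by at most one width, by the choice of
eta. *)
Lemma cell_skew v i :
  `|skew u i0 v i / skew_side i - (cell v i)%:~R| <= 2.
Proof.
rewrite /skew /skew_side ffunE.
have A : v 0 i0 / u 0 i0 / eta = v 0 i0 / (eta * u 0 i0).
  by rewrite invfM mulrA mulrAC.
have F := floor_dist (v 0 i0 / (eta * u 0 i0)).
case: ifPn => [_|ii0]; first by rewrite A (le_trans F)// ler1n.
set k0 := (Num.floor (v 0 i0 / (eta * u 0 i0)))%:~R in F *.
have -> : (v 0 i - u 0 i * (v 0 i0 / u 0 i0)) / w i =
   (v 0 i - u 0 i * (eta * k0)) / w i -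
   (v 0 i0 / (eta * u 0 i0) - k0) * (u 0 i * eta / w i).
  by field; rewrite ui0 !gt_eqF.
rewrite addrAC; apply: le_trans (ler_normB _ _) _.
rewrite -[leRHS]/(1 + 1); apply: lerD; first exact: floor_dist.
rewrite normrM -[leRHS]mulr1; apply: ler_pM => //.
rewrite !normrM normfV (gtr0_norm eta0) (gtr0_norm (w0 i)) ler_pdivrMr// mul1r.
exact: etaw.
Qed.

End cells.

(** * Weighted walks through the cells *)

Lemma sum_expR_dist (R : realType) (t : R) (a : int) n : 0 < t ->
  \sum_(j < n) expR (- (t * `|j%:Z - a|%:~R)) <= 2 / (1 - expR (- t)).
Proof.
move=> t0; have e1 : expR (- t) < 1 by rewrite expR_lt1; lra.
have e0 := expR_gt0 (- t).
(* F is a bounded function whose increments dominate the summands. *)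
pose F (b : int) : R := if b <= 0 then expR (t * (b%:~R - 1)) else 2 - expR (- (t * b%:~R)).
have F0 b : 0 <= F b.
  rewrite /F; case: ifPn; first by rewrite expR_ge0.
  rewrite -ltNge => b0; have : expR (- (t * b%:~R)) <= 1 :> R.
    by rewrite expR_le1 oppr_le0 mulr_ge0// ?(ltW t0)// ler0z ltW.
  by lra.
have F2 b : F b <= 2.
  rewrite /F; case: ifPn => [b0|_]; last by have := expR_gt0 (- (t * b%:~R)); lra.
  have : expR (t * (b%:~R - 1)) <= 1 :> R.
    rewrite expR_le1 pmulr_rle0//; move: b0; rewrite -(ler_int R); lra.
  by lra.
have step (b : int) : expR (- (t * `|b|%:~R)) * (1 - expR (- t)) <= F (b + 1) - F b.
  have [b0|b0|->] := ltgtP b 0.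
  - have b1 : b + 1 <= 0 by lia.
    rewrite /F b1 (ltW b0) ltr0_norm// intrD addrK.
    have -> : t * (b%:~R - 1) = t * b%:~R - t :> R by ring.
    by rewrite expRD intrN mulrN opprK; lra.
  - have b1 : (b + 1 <= 0) = false by lia.
    have b2 : (b <= 0) = false by lia.
    rewrite /F b1 b2 gtr0_norm// intrD.
    have -> : - (t * (b%:~R + 1)) = - (t * b%:~R) - t :> R by ring.
    by rewrite expRD; lra.
  - rewrite /F add0r lexx /= normr0 mulr0 oppr0 expR0 mulr1.
    by rewrite sub0r mulrN1; lra.
suff : (\sum_(j < n) expR (- (t * `|j%:Z - a|%:~R))) * (1 - expR (- t)) <=
    F (n%:Z - a) - F (0%:Z - a).
  rewrite ler_pdivlMr ?subr_gt0// => /le_trans; apply.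
  by have := F0 (0%:Z - a); have := F2 (n%:Z - a); lra.
elim: n => [|n IH]; first by rewrite big_ord0 mul0r subrr.
rewrite big_ord_recr/= mulrDl; have := step (n%:Z - a).
by rewrite (_ : n%:Z - a + 1 = n.+1%:Z - a); [lra|lia].
Qed.

Lemma geometric_le (R : realType) (t : R) : 0 < t ->
  2 / (1 - expR (- t)) <= 2 * (1 + t) / t.
Proof.
move=> t0; have e1 : expR (- t) < 1 by rewrite expR_lt1; lra.
rewrite -!mulrA ler_pM2l// -[(1 + t) / t]invf_div lef_pV2 ?posrE ?subr_gt0//;
  last by rewrite divr_gt0//; lra.
rewrite ler_pdivrMr; last by lra.
have := expR_ge1Dx t; have := expR_gt0 (- t); have := expRxMexpNx_1 t.
by nra.
Qed.

Section boxes.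
Context (d : nat).
Local Notation K := {ffun 'I_d -> int}.

Definition box M : seq K :=
  [seq [ffun i => (g i)%:Z - M%:Z] | g : {ffun 'I_d -> 'I_(M.*2.+1)}].

Lemma mem_box M (k : K) : (forall i, (absz (k i) <= M)%N) -> k \in box M.
Proof.
move=> h; apply/fintype.imageP; exists [ffun i => inord (absz (k i + M%:Z)%R)] => //.
apply/ffunP => i; rewrite !ffunE; move: (k i) (h i) => z hz.
by rewrite inordK; lia.
Qed.

Lemma box_sub M M' k : (M <= M')%N -> k \in box M -> k \in box M'.
Proof.
move=> MM /fintype.imageP[g _ ->]; apply: mem_box => i; rewrite ffunE.
by move: (nat_of_ord (g i)) (ltn_ord (g i)) => z hz; lia.
Qed.

Fixpoint box_seqs M m : seq (seq K) :=
  if m is m'.+1 then [seq k :: ks | k <- box M, ks <- box_seqs M m'] else [:: [::]].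

Lemma size_box_seqs M m ks : ks \in box_seqs M m -> size ks = m.
Proof.
elim: m ks => [|m IH] ks /=; first by rewrite inE => /eqP ->.
by move=> /allpairsP[[k ks'] /= [_ /IH <- ->]].
Qed.

Lemma mem_box_seqs M ks : {in ks, forall k : K, k \in box M} ->
  ks \in box_seqs M (size ks).
Proof.
elim: ks => //= k ks IH h; apply/allpairsP; exists (k, ks); split => //=.
  by apply: h; rewrite inE eqxx.
by apply: IH => z zk; apply: h; rewrite inE zk orbT.
Qed.

Lemma all_box_seqs M m ks : ks \in box_seqs M m -> {in ks, forall k, k \in box M}.
Proof.
elim: m ks => [|m IH] ks /=; first by rewrite inE => /eqP ->.
move=> /allpairsP[[k ks'] /= [kM /IH ksM ->]] z.
by rewrite inE => /orP[/eqP ->//|/ksM].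
Qed.

Lemma bounded_seq (ks : seq K) : exists M0, forall M, (M0 <= M)%N ->
  {in ks, forall k, k \in box M}.
Proof.
elim: ks => [|k ks [M0 IH]]; first by exists 0%N.
exists (maxn M0 (\max_i `|k i|%N)) => M; rewrite geq_max => /andP[h1 h2] z.
rewrite inE => /orP[/eqP ->|]; last exact: IH.
apply: mem_box => i; have : (`|k i| <= \max_i `|k i|)%N.
  exact: (@leq_bigmax _ (fun i : 'I_d => absz (k i)) i).
by lia.
Qed.

End boxes.

Section walks.
Context (R : realType) (d : nat) (i0 : 'I_d) (n : nat) (c : R).
Hypotheses (n0 : (0 < n)%N) (c0 : 0 < c).
Local Notation K := {ffun 'I_d -> int}.

(** The coordinate i0 counts slabs, n of which make up the length of a box. *)
Definition omega (i : 'I_d) : R := if i == i0 then n%:R^-1 else 1.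

Lemma omega_gt0 i : 0 < omega i.
Proof. by rewrite /omega; case: ifP => //; rewrite invr_gt0 ltr0n. Qed.

Lemma omega_le1 i : omega i <= 1.
Proof. by rewrite /omega; case: ifP => // _; rewrite invf_le1 ?ler1n// ltr0n. Qed.

Definition hop (k k' : K) : R := \sum_i omega i * `|k' i - k i|%:~R.

Fixpoint walk (k : K) (ks : seq K) : R :=
  if ks is k' :: ks' then hop k k' + walk k' ks' else 0.

(** One factor [geometric_le] per coordinate. *)
Definition hop_const : R := (2 * (1 + c) / c) ^+ d.

Lemma hop_const_gt0 : 0 < hop_const.
Proof. by rewrite exprn_gt0// divr_gt0// mulr_gt0// addr_gt0. Qed.

(** The weight is a product over the coordinates, hence so is the sum. The factor
n comes from the slabs, and will compensate for the volume of a cell being 1 / n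
of that of a box. *)
Lemma sum_hop M k : \sum_(k' <- box d M) expR (- (c * hop k k')) <= hop_const * n%:R.
Proof.
rewrite big_image/=.
under eq_bigr => g _.
  rewrite (_ : expR _ = \prod_i expR (- (c * omega i *
      `|(g i)%:Z - (k i + M%:Z)|%:~R))); last first.
    rewrite -expR_sum; congr expR; rewrite sumrN; congr (- _).
    rewrite /hop mulr_sumr; apply: eq_bigr => i _; rewrite ffunE mulrA.
    by congr (_ * `|_|%:~R); ring.
  over.
rewrite -(bigA_distr_bigA (fun i (j : 'I_(M.*2.+1)) => expR (- (c * omega i *
      `|j%:Z - (k i + M%:Z)|%:~R)))).
have -> : hop_const * n%:R = \prod_(i < d) (2 * (1 + c) / c / omega i).
  rewrite big_split/= prodr_const card_ord; congr (_ * _).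
  rewrite (bigD1 i0)//= big1 ?mulr1; first by rewrite /omega eqxx invrK.
  by move=> i ii0; rewrite /omega (negbTE ii0) invr1.
apply: ler_prod => i _; rewrite sumr_ge0 => [/=|j _]; last exact: expR_ge0.
have t0 : 0 < c * omega i by rewrite mulr_gt0// omega_gt0.
apply: le_trans (sum_expR_dist _ _ t0) _; apply: le_trans (geometric_le t0) _.
rewrite invfM !mulrA ler_wpM2r ?invr_ge0 ?(ltW (omega_gt0 i))//.
rewrite ler_wpM2r ?invr_ge0 ?(ltW c0)// ler_wpM2l// lerD2l.
by rewrite ler_piMr ?omega_le1// ltW.
Qed.

Lemma sum_walk M m k :
  \sum_(ks <- box_seqs d M m) expR (- (c * walk k ks)) <= (hop_const * n%:R) ^+ m.
Proof.
elim: m k => [|m IH] k /=; first by rewrite big_seq1 mulr0 oppr0 expR0.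
rewrite big_allpairs_dep/= exprS.
under eq_bigr => k' _.
  under eq_bigr => ks _ do rewrite mulrDr opprD expRD.
  rewrite -mulr_sumr; over.
apply: le_trans (_ : \sum_(k' <- box d M) expR (- (c * hop k k')) *
   (hop_const * n%:R) ^+ m <= _).
  by apply: ler_sum => k' _; rewrite ler_wpM2l ?expR_ge0.
rewrite -mulr_suml ler_wpM2r ?sum_hop// exprn_ge0// mulr_ge0//.
exact: ltW hop_const_gt0.
Qed.

End walks.

(** * Fast paths are unlikely *)

Lemma mem_bigsetU (T : Type) (I : eqType) (r : seq I) (Q : pred I)
    (A : I -> set T) w :
  (\big[setU/set0]_(i <- r | Q i) A i) w <-> exists i, [/\ i \in r, Q i & A i w].
Proof.
elim: r => [|i r IH]; first by rewrite big_nil; split => // -[i []].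
rewrite big_cons; case: ifPn => Qi; split.
- move=> [Aw|/IH[j [jr Qj Aj]]]; first by exists i; rewrite inE eqxx.
  by exists j; rewrite inE jr orbT.
- move=> [j [+ Qj Aj]]; rewrite inE => /orP[/eqP ji|jr].
    by left; rewrite -ji.
  by right; apply/IH; exists j.
- by move=> /IH[j [jr Qj Aj]]; exists j; rewrite inE jr orbT.
- move=> [j [+ Qj Aj]]; rewrite inE => /orP[/eqP ji|jr].
    by rewrite -ji Qj in Qi.
  by apply/IH; exists j.
Qed.

Lemma prob_bigsetU (R : realType) (disp : measure_display)
    (T : measurableType disp) (P : probability T R) (I : Type) (r : seq I)
    (Q : pred I) (A : I -> set T) : (forall i, measurable (A i)) ->
  measurable (\big[setU/set0]_(i <- r | Q i) A i) /\
  (P (\big[setU/set0]_(i <- r | Q i) A i) <= \sum_(i <- r | Q i) P (A i))%E.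
Proof.
move=> mA; elim: r => [|i r [IHm IH]]; first by rewrite !big_nil measure0.
rewrite !big_cons; case: ifP => // _; split; first exact: measurableU.
apply: (@le_trans _ _ (P (A i) + P (\big[setU/set0]_(i <- r | Q i) A i))%E).
  by apply: measureU2 => //; exact: mA.
exact: leeD2l.
Qed.

Lemma sum_half_le2 (R : realType) (q : R) M : 0 <= q <= 2^-1 ->
  \sum_(m < M) q ^+ m <= 2.
Proof.
move=> /andP[q0 q2].
suff : \sum_(m < M) q ^+ m <= 2 - 2 * 2^-1 ^+ M.
  by have : 0 <= 2^-1 ^+ M :> R by []; lra.
elim: M => [|M IH]; first by rewrite big_ord0 expr0; lra.
rewrite big_ord_recr/= exprS; have : q ^+ M <= 2^-1 ^+ M by rewrite lerXn2r// nnegrE.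
by lra.
Qed.

Section lower_bound.
Context (R : realType) (d : nat) (disp : measure_display)
  (T : measurableType disp) (P : probability T R) (Xi : T -> set 'rV[R]_d)
  (p : \bar R) (u : 'rV[R]_d) (i0 : 'I_d) (beta : 'I_d -> R) (f : 'rV[R]_d)
  (c eps x : R) (n : nat).
Hypotheses (p1 : (1 <= p)%E) (AD : adapted p u i0 beta f c)
  (PP : poisson_process P Xi) (eps0 : 0 < eps) (x0 : 0 < x) (x1 : x <= 1)
  (n0 : (0 < n)%N).
Let delta : R := eps `^ d%:R^-1.
Let eta : R := delta / (x * n%:R).
Let w (i : 'I_d) : R := delta * x `^ (- beta i).
Hypothesis etaw : forall i, i != i0 -> `|u 0 i| * eta <= w i.
Local Notation K := {ffun 'I_d -> int}.
Local Notation cell := (cell u i0 eta w).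
Local Notation walk := (walk R i0 n).

Let ui0 : u 0 i0 != 0 := ad_u AD.
Let c0 : 0 < c := ad_c AD.
Let delta0 : 0 < delta. Proof. exact: powR_gt0. Qed.
Let nR : 0 < n%:R :> R. Proof. by rewrite ltr0n. Qed.
Let eta0 : 0 < eta. Proof. by rewrite divr_gt0// mulr_gt0. Qed.
Let w0 i : 0 < w i. Proof. by rewrite mulr_gt0// powR_gt0. Qed.

Lemma omega_side i : omega R i0 n i / skew_side i0 eta w i = x `^ beta i / delta.
Proof.
rewrite /omega /skew_side; case: ifPn => [/eqP ->|_].
  rewrite (ad_beta0 AD) powRr1 ?(ltW x0)// /eta; field.
  by rewrite !gt_eqF.
by rewrite /w powRN; field; rewrite !gt_eqF// powR_gt0.
Qed.

Lemma hop_skew v v' : delta * (hop R i0 n (cell v) (cell v') - 4 * d%:R) <=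
  \sum_i x `^ beta i * `|skew u i0 (v' - v) i|.
Proof.
rewrite mulrC -ler_pdivlMr//.
have -> : 4 * d%:R = \sum_(i < d) 4 :> R.
  by rewrite sumr_const card_ord mulr_natr.
rewrite /hop -sumrB mulr_suml; apply: ler_sum => i _.
have om0 := omega_gt0 R i0 n0 i; have om1 := omega_le1 R i0 n0 i.
have -> : x `^ beta i * `|skew u i0 (v' - v) i| / delta =
    omega R i0 n i * `|skew u i0 v' i / skew_side i0 eta w i -
                        skew u i0 v i / skew_side i0 eta w i|.
  rewrite mulrAC -omega_side -mulrBl normrM normfV skewB.
  rewrite (gtr0_norm (_ : 0 < skew_side i0 eta w i)); first by ring.
  by rewrite /skew_side; case: ifP.
have h1 := cell_skew ui0 eta0 w0 etaw v i.
have h2 := cell_skew ui0 eta0 w0 etaw v' i.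
set a := skew u i0 v i / _ in h1 *; set b := skew u i0 v' i / _ in h2 *.
have -> : `|cell v' i - cell v i|%:~R = `|(cell v' i)%:~R - (cell v i)%:~R| :> R.
  by rewrite -intrB intr_norm.
set k := (cell v i)%:~R in h1 *; set k' := (cell v' i)%:~R in h2 *.
have : `|k' - k| <= `|b - a| + 4.
  have -> : k' - k = (b - a) - ((b - k') - (a - k)) by ring.
  apply: le_trans (ler_normB _ _) _; rewrite lerD2l.
  by apply: le_trans (ler_normB _ _) _; lra.
by have := normr_ge0 (b - a); nra.
Qed.

(** Sum of [ad_low] over the steps. The last step only contributes its length,
since y is not a Poisson point. *)
Lemma chain_walk z cs y :
  linf f (y - z) + c * (delta * (walk (cell z) (map cell cs) - 4 * d%:R * (size cs)%:R))
  <= (1 + x) * (chain p delta z (rcons cs y) + delta * (size cs).+1%:R).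
Proof.
have stepP v : linf f v + c * (\sum_i x `^ beta i * `|skew u i0 v i|) <=
    (1 + x) * (Num.max 0 (pnorm p v - delta) + delta).
  apply: le_trans (ad_low AD v (_ : 0 < x <= 1)) _; first by rewrite x0.
  rewrite ler_wpM2l//; first by rewrite addr_ge0// ltW.
  have : pnorm p v - delta <= Num.max 0 (pnorm p v - delta) by rewrite le_max lexx orbT.
  by lra.
elim: cs z => [|a cs IH] z /=.
  have := stepP (y - z); have : 0 <= c * (\sum_i x `^ beta i * `|skew u i0 (y - z) i|).
    by rewrite mulr_ge0 ?(ltW c0)//; apply: sumr_ge0 => i _; rewrite mulr_ge0// powR_ge0.
  by rewrite !mulr0 subr0 !mulr0 mulr1 !addr0; lra.
have := IH a; have := stepP (a - z).
have : c * (delta * (hop R i0 n (cell z) (cell a) - 4 * d%:R)) <=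
    c * (\sum_i x `^ beta i * `|skew u i0 (a - z) i|).
  by rewrite ler_pM2l//; exact: hop_skew.
have -> : linf f (y - z) = linf f (a - z) + linf f (y - a).
  by rewrite -linfD; congr linf; apply/rowP => i; rewrite !mxE; ring.
have -> : (size cs).+2%:R = (size cs).+1%:R + 1 :> R by rewrite natr1.
have -> : (size cs).+1%:R = (size cs)%:R + 1 :> R by rewrite natr1.
by move=> h1 h2 h3; lra.
Qed.

Let a : R := 4 * c * d%:R + 2.
Let l : R := cell_volume u i0 eta w.
Hypothesis small : l * expR a * (hop_const d c * n%:R) <= 2^-1.

Lemma slow_volume_gt0 : 0 < l. Proof. exact: cell_volume_gt0. Qed.

Section slow.
Context (s : R).
Hypothesis s0 : 0 < s.
Let S : R := s * x / delta.

(** Satisfied by the cells of a fast chain: the distance S can only be covered by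
short hops if there are many of them. *)
Definition short_walk (ks : seq K) : bool :=
  c * walk 0 ks <= a * (size ks)%:R + 2 - S.

Lemma short_walk_chain cs :
  chain p delta 0 (rcons cs (s *: u)) < s * (1 - 2 * x) -> short_walk (map cell cs).
Proof.
move=> h; have := chain_walk 0 cs (s *: u).
rewrite subr0 linfZ (ad_f AD) mulr1 cell0 /short_walk size_map => H.
set m : R := (size cs)%:R in H *.
have m0 : 0 <= m by [].
have mE : (size cs).+1%:R = m + 1 :> R by rewrite natr1.
set W := walk 0 _ in H *; set ch := chain _ _ _ _ in h H.
rewrite mE in H.
have D0 : 0 <= delta * (m + 1) by rewrite mulr_ge0 ?(ltW delta0)//; lra.
have H1 : s + c * (delta * (W - 4 * d%:R * m)) <= s - s * x + 2 * (delta * (m + 1)).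
  apply: le_trans H _.
  have : (1 + x) * (ch + delta * (m + 1)) <=
      (1 + x) * (s * (1 - 2 * x) + delta * (m + 1)).
    by rewrite ler_wpM2l ?addr_ge0 ?(ltW x0)// lerD2r ltW.
  have : x * (delta * (m + 1)) <= delta * (m + 1) by rewrite ler_piMl.
  have : 0 <= s * x ^+ 2 by rewrite mulr_ge0 ?sqr_ge0 ?ltW.
  rewrite expr2; lra.
have : delta * (c * W) <= delta * (a * m + 2 - S).
  rewrite /a /S mulrBr [delta * (s * x / delta)]mulrC mulfVK ?gt_eqF//.
  by move: H1; rewrite !(mulrDr, mulrBr, mulrDl, mulrBl); lra.
by rewrite ler_pM2l.
Qed.

Local Notation crowded := (crowded Xi cell).

Definition short_crowded M : set T :=
  \big[setU/set0]_(m <- iota 0 M.+1)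
    \big[setU/set0]_(ks <- box_seqs d M m | short_walk ks) crowded ks.

Lemma short_crowdedP M t : short_crowded M t <-> exists ks, [/\ (size ks <= M)%N,
  ks \in box_seqs d M (size ks), short_walk ks & crowded ks t].
Proof.
rewrite /short_crowded; split.
  move=> /mem_bigsetU[m [+ _ /mem_bigsetU[ks [kM fks cks]]]].
  rewrite mem_iota add0n ltnS /= => mM; exists ks.
  by rewrite (size_box_seqs kM).
move=> [ks [sM kM fks cks]]; apply/mem_bigsetU; exists (size ks).
rewrite mem_iota/= add0n ltnS; split => //.
by apply/mem_bigsetU; exists ks.
Qed.

Lemma measurable_cell_crowded ks : measurable (crowded ks).
Proof.
by apply: (measurable_crowded PP) => k; exact: borel_cell.
Qed.

(** A Chernoff bound: an exponential weight replaces the constraint, and makes the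
sum over the sequences of cells a power. *)
Lemma short_crowded_prob M : measurable (short_crowded M) /\
  (P (short_crowded M) <= (2 * expR (2 - S))%:E)%E.
Proof.
pose B m := \big[setU/set0]_(ks <- box_seqs d M m | short_walk ks) crowded ks.
have BP m := prob_bigsetU P (box_seqs d M m) short_walk measurable_cell_crowded.
have [mb Pb] := prob_bigsetU P (iota 0 M.+1) xpredT (fun m => (BP m).1).
split => //; apply: le_trans Pb _.
have Bq m : (P (B m) <= (expR (2 - S) * (l * expR a * (hop_const d c * n%:R)) ^+ m)%:E)%E.
  apply: le_trans (BP m).2 _.
  apply: (@le_trans _ _ (\sum_(ks <- box_seqs d M m)
      (l ^+ m * expR (a * m%:R + 2 - S) * expR (- (c * walk 0 ks)))%:E)%E).
    rewrite big_mkcond/= big_seq [leRHS]big_seq; apply: lee_sum => ks /size_box_seqs sk.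
    case: ifPn => [fk|_]; last first.
      by rewrite lee_fin !mulr_ge0 ?expR_ge0// exprn_ge0// ltW// slow_volume_gt0.
    have := crowded_prob PP (borel_cell ui0 eta0 w0) (lebesgue_cell ui0 eta0 w0)
      slow_volume_gt0 ks.
    move/le_trans; apply; rewrite lee_fin sk -mulrA ler_peMr//.
      by rewrite exprn_ge0// ltW// slow_volume_gt0.
    rewrite -expRD; apply: le_trans (expR_ge1Dx _); rewrite lerDl.
    by move: fk; rewrite /short_walk sk -subr_ge0.
  rewrite sumEFin lee_fin -mulr_sumr.
  apply: le_trans (ler_wpM2l _ (sum_walk i0 n0 c0 M m 0)) _.
    by rewrite mulr_ge0 ?expR_ge0// exprn_ge0// ltW// slow_volume_gt0.
  rewrite le_eqVlt; apply/orP; left; apply/eqP.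
  rewrite [in RHS]exprMn [in RHS]exprMn -expRM_natr.
  have -> : a * m%:R + 2 - S = (2 - S) + a * m%:R by ring.
  by rewrite expRD; ring.
apply: (@le_trans _ _ (\sum_(m <- iota 0 M.+1)
    (expR (2 - S) * (l * expR a * (hop_const d c * n%:R)) ^+ m)%:E)%E).
  by apply: lee_sum => m _; exact: Bq.
rewrite sumEFin lee_fin -mulr_sumr mulrC ler_wpM2r ?expR_ge0//.
have -> : iota 0 M.+1 = index_iota 0 M.+1 by rewrite /index_iota subn0.
rewrite big_mkord; apply: sum_half_le2; rewrite small andbT.
have h0 := hop_const_gt0 d c0; have l0 := slow_volume_gt0.
by apply: mulr_ge0; apply: mulr_ge0; rewrite ?expR_ge0// ltW.
Qed.

Lemma short_crowded_nondecreasing : nondecreasing_seq short_crowded.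
Proof.
move=> M M' MM; apply/subsetPset => t /short_crowdedP[ks [sM kM fks cks]].
apply/short_crowdedP; exists ks; split => //; first exact: leq_trans MM.
apply: mem_box_seqs => k kks; apply: box_sub MM _.
exact: (all_box_seqs kM).
Qed.

(** A path that is too fast gives a chain that is too fast, whose cells are
crowded and form a short walk. *)
Theorem travel_time_lower : exists A, [/\ measurable A,
  (P A <= (2 * expR (2 - S))%:E)%E &
  forall t, ~ A t -> s * (1 - 2 * x) <= travel_time p eps (Xi t) 0 (s *: u)].
Proof.
exists (\bigcup_M short_crowded M).
have mB M : measurable (short_crowded M) := (short_crowded_prob M).1.
have mU : measurable (\bigcup_M short_crowded M) by exact: bigcupT_measurable.
split => //.
  have cv := @nondecreasing_cvg_mu _ _ _ P _ mB mU short_crowded_nondecreasing.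
  rewrite -(cvg_lim _ cv)//; apply: lime_le.
    by apply/cvg_ex; eexists; exact: cv.
  by apply: nearW => M; exact: (short_crowded_prob M).2.
move=> t nt; apply: lb_le_inf.
  by exists (path_time p eps (Xi t) 0 (s *: u) [::]); exists [::].
move=> _ [pi _ <-]; rewrite leNgt; apply/negP => slow.
have [cs [ucs csX le]] := path_time_chain eps (s *: u) pi p1 (pp_locally_finite PP t).
have fk := short_walk_chain (le_lt_trans le slow).
apply: nt; have [M0 hM] := bounded_seq (map cell cs).
pose M := maxn M0 (size cs).
exists M => //; apply/short_crowdedP; exists (map cell cs); split => //.
- by rewrite size_map leq_maxr.
- by apply: mem_box_seqs; apply: hM; exact: leq_maxl.
- exact: crowded_points.
Qed.

End slow.
End lower_bound.

(** * A path through occupied boxes *)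

Section upper_bound.
Context (R : realType) (d : nat) (disp : measure_display)
  (T : measurableType disp) (P : probability T R) (Xi : T -> set 'rV[R]_d)
  (p : \bar R) (u : 'rV[R]_d) (i0 : 'I_d) (beta : 'I_d -> R) (f : 'rV[R]_d)
  (c eps x : R) (n : nat).
Hypotheses (p1 : (1 <= p)%E) (AD : adapted p u i0 beta f c)
  (PP : poisson_process P Xi) (eps0 : 0 < eps) (x0 : 0 < x) (x1 : x <= 1)
  (xu : x <= `|u 0 i0|) (n0 : (0 < n)%N).
Let delta : R := eps `^ d%:R^-1.
Let L : R := delta / x.
Let eta : R := delta / (x * n%:R).
Let w (i : 'I_d) : R := c / 4 * (delta * x `^ (- beta i)).
Hypothesis etaw : forall i, i != i0 -> `|u 0 i| * eta <= w i.
Local Notation cell := (cell u i0 eta w).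

Let ui0 : u 0 i0 != 0 := ad_u AD.
Let c0 : 0 < c := ad_c AD.
Let delta0 : 0 < delta. Proof. exact: powR_gt0. Qed.
Let nR : 0 < n%:R :> R. Proof. by rewrite ltr0n. Qed.
Let eta0 : 0 < eta. Proof. by rewrite divr_gt0// mulr_gt0. Qed.
Let L0 : 0 < L. Proof. by rewrite divr_gt0. Qed.
Let w0 i : 0 < w i. Proof. by rewrite mulr_gt0 ?divr_gt0// mulr_gt0// powR_gt0. Qed.
Let neta : n%:R * eta = L. Proof. by rewrite /eta /L; field; rewrite !gt_eqF. Qed.
Local Notation tt := (skew u i0 ^~ i0).

Definition slab (j : nat) : {ffun 'I_d -> int} :=
  [ffun i => if i == i0 then j%:Z else 0].

(** The slabs of the box of index g. Successive boxes are one length apart, so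
that the steps between them are long enough for [ad_up]. *)
Definition group (g : nat) : seq {ffun 'I_d -> int} :=
  [seq slab j | j <- iota ((2 * g).+1 * n) n].

Lemma uniq_group g : uniq (group g).
Proof.
rewrite map_inj_uniq ?iota_uniq// => j j' /ffunP/(_ i0).
by rewrite !ffunE eqxx => -[].
Qed.

Definition occupied g : set T := ~` [set t | forall q, q \in group g ->
  point_count Xi [set v | cell v = q] t = 0%E].

Let l : R := cell_volume u i0 eta w.

Lemma occupied_prob g : measurable (occupied g) /\
  P (occupied g) = (1 - expR (- (n%:R * l)))%:E.
Proof.
have [mE PE] := all_empty_prob PP (borel_cell ui0 eta0 w0)
  (lebesgue_cell ui0 eta0 w0) (cell_volume_gt0 ui0 eta0 w0) (uniq_group g).
split; first exact: measurableC.
by rewrite probability_setC// PE size_map size_iota.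
Qed.

Let odd_natr k : (2 * k).+1%:R = 2 * k%:R + 1 :> R.
Proof. by rewrite -natr1 natrM. Qed.

Lemma occupied_point g t : occupied g t -> exists v, [/\ Xi t v,
  (2 * g).+1%:R * L <= tt v, tt v < (2 * g).+2%:R * L &
  forall i, i != i0 -> `|skew u i0 v i| <= 2 * w i].
Proof.
move=> /existsNP[q /not_implyP[/mapP[j jg ->] ne]].
have [v [Xv cv]] : exists v, Xi t v /\ cell v = slab j.
  apply: contrapT => h; apply: ne; rewrite /point_count.
  have -> : Xi t `&` [set v | cell v = slab j] = set0.
    by rewrite -subset0 => v [Xv cv]; apply: h; exists v.
  by rewrite /counting asboolT// fset_set0.
have h i := cell_skew ui0 eta0 w0 etaw v i.
have jv : cell v i0 = j%:Z by rewrite cv ffunE eqxx.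
have tv : tt v / eta = v 0 i0 / (eta * u 0 i0).
  by rewrite /skew eqxx; field; rewrite ui0 gt_eqF.
move: jv; rewrite ffunE eqxx => /floorP; rewrite -tv intrD1 => /andP[h1 h2].
move: jg; rewrite mem_iota -mulSnr => /andP[g1 g2].
exists v; split => //.
- rewrite -neta mulrA -ler_pdivlMr//; apply: le_trans h1.
  by rewrite -natrM -[leRHS]/(j%:R) ler_nat.
- rewrite -neta mulrA -ltr_pdivrMr//; apply: lt_le_trans h2 _.
  by rewrite -natrM -[j%:~R]/(j%:R) natr1 ler_nat.
- move=> i ii0; have := h i; rewrite cv ffunE (negbTE ii0) subr0.
  rewrite /skew_side (negbTE ii0) normrM normfV (gtr0_norm (w0 i)).
  by rewrite ler_pdivrMr.
Qed.

Lemma detour_step a b : L <= tt (b - a) ->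
  (forall i, i != i0 -> `|skew u i0 a i| <= 2 * w i) ->
  (forall i, i != i0 -> `|skew u i0 b i| <= 2 * w i) ->
  pnorm p (b - a) <= linf f (b - a) + delta / 4.
Proof.
move=> h1 ha hb.
have di0 : 0 < delta^-1 by rewrite invr_gt0.
have := @ad_up _ _ _ _ _ _ _ _ AD x (delta^-1 *: (b - a)).
rewrite x0 x1 linfZ pnormZ// (gtr0_norm di0) => /(_ isT).
have -> : linf f (b - a) + delta / 4 = delta * (delta^-1 * linf f (b - a) + 4^-1).
  by field; rewrite gt_eqF.
rewrite -[X in _ -> X <= _](mulVKf (lt0r_neq0 delta0)) ler_pM2l//; apply.
  move=> i ii0; rewrite skewZ normrM (gtr0_norm di0) skewB mulrC ler_pdivrMr//.
  apply: le_trans (ler_normB _ _) _; have := ha i ii0; have := hb i ii0.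
  by rewrite /w; lra.
rewrite skewZ mulrC ler_pdivlMr// mulrC.
exact: h1.
Qed.

Lemma plength_occupied t a b : Xi t a -> L <= tt (b - a) ->
  plength p a b (~` Sigma p eps (Xi t)) <= pnorm p (b - a) - delta / 2.
Proof.
move=> Xa h; have N1 : delta <= pnorm p (b - a).
  apply: le_trans (ler_coord_pnorm (b - a) i0 p1).
  have -> : (b - a) 0 i0 = tt (b - a) * u 0 i0 by rewrite /skew eqxx divfK.
  rewrite normrM ger0_norm; last by apply: le_trans h; exact: ltW.
  have : L * x = delta by rewrite /L divfK ?gt_eqF.
  move=> <-; apply: ler_pM => //; exact: ltW.
apply: plength_le_center => //; first exact: pp_locally_finite PP t.
  by have d0 := delta0; rewrite -/delta; lra.
exact: lt_le_trans N1.
Qed.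

(** By induction on the number m of boxes ahead of z: go to a point of the next
box if it is occupied. The gain is what is saved at z itself, that is delta / 2
unless z is the origin. *)
Lemma occupied_path t G m z gain : (m <= G)%N ->
  tt z <= 2 * (G - m)%:R * L ->
  (forall i, i != i0 -> `|skew u i0 z i| <= 2 * w i) ->
  (forall b, L <= tt (b - z) ->
    plength p z b (~` Sigma p eps (Xi t)) <= pnorm p (b - z) - gain) ->
  let y := ((2 * G).+1%:R * L) *: u in
  exists cs, [/\ {in cs, forall v, Xi t v}, uniq cs,
    {in cs, forall v, tt z < tt v < tt y} &
    (size cs)%:R = \sum_(g <- iota (G - m) m) \1_(occupied g) t :> R] /\
    path_time p eps (Xi t) z y cs <=
      linf f (y - z) + delta / 4 - gain - delta / 4 * (size cs)%:R.
Proof.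
set y := _ *: u.
have ty : tt y = (2 * G).+1%:R * L by rewrite skewZ skew_dir// eqxx mulr1.
have sy i : i != i0 -> `|skew u i0 y i| <= 2 * w i.
  by move=> ii0; rewrite skewZ skew_dir// (negbTE ii0) mulr0 normr0 mulr_ge0// ltW.
elim: m z gain => [|m IH] z gain mG tz sz hz /=.
  exists [::]; split; first by split => //; rewrite big_nil.
  have tyz : L <= tt (y - z).
    by rewrite skewB ty; move: tz; rewrite subn0 odd_natr; have := L0; lra.
  rewrite /path_time/= big_cons big_nil/= addr0 mulr0 subr0.
  by apply: le_trans (hz _ tyz) _; have := detour_step tyz sz sy; have := delta0; lra.
have gm : (G - m.+1).+1 = (G - m)%N by rewrite subnSK.
set g := (G - m.+1)%N in gm tz *.
have gL : g.+1%:R * L <= G%:R * L by rewrite ler_wpM2r ?(ltW L0)// ler_nat gm leq_subr.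
rewrite big_cons indicE; have [Eg|Eg] := pselect (occupied g t); last first.
  rewrite (memNset Eg) add0r gm; apply: IH => //; first exact: ltnW.
  apply: le_trans tz _; rewrite ler_wpM2r ?(ltW L0)// ler_wpM2l// ler_nat.
  by rewrite -gm.
have [v [Xv v1 v2 sv]] := occupied_point Eg.
have zv : L <= tt (v - z).
  by rewrite skewB; move: v1; rewrite odd_natr; have := L0; lra.
have [||||cs [[csX ucs tcs scs] pcs]] := IH v (delta / 2).
- exact: ltnW.
- apply: ltW; apply: lt_le_trans v2 _; rewrite ler_wpM2r ?(ltW L0)//.
  by rewrite -natrM ler_nat -gm mulnS.
- exact: sv.
- by move=> b; exact: plength_occupied.
exists (v :: cs); split; last first.
  rewrite /path_time/= big_cons/=.
  have := detour_step zv sz sv; have := hz _ zv.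
  have -> : linf f (y - z) = linf f (v - z) + linf f (y - v).
    by rewrite -linfD; congr linf; apply/rowP => i; rewrite !mxE; ring.
  have -> : (size cs).+1%:R = (size cs)%:R + 1 :> R by rewrite natr1.
  by move: pcs; rewrite /path_time; lra.
have zv' : tt z < tt v by move: zv; rewrite skewB; have := L0; lra.
have vy : tt v < tt y.
  rewrite ty; apply: lt_le_trans v2 _; move: gL.
  rewrite -[(2 * g).+2%:R]natr1 !odd_natr -[g.+1%:R]natr1.
  by have := L0; lra.
split.
- by move=> a; rewrite inE => /orP[/eqP ->//|/csX].
- rewrite /= ucs andbT; apply/negP => /tcs; by rewrite ltxx.
- move=> a; rewrite inE => /orP[/eqP ->|/tcs /andP[h1 h2]]; first by rewrite zv' vy.
  by rewrite h2 andbT (lt_trans zv').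
- by rewrite (mem_set Eg) gm -scs /= addrC natr1.
Qed.

Theorem travel_time_upper t G s : s = (2 * G).+1%:R * L ->
  travel_time p eps (Xi t) 0 (s *: u) <=
    s + delta / 4 - delta / 4 * \sum_(g < G) \1_(occupied g) t.
Proof.
move=> ->.
have sk0 i : skew u i0 0 i = 0 by rewrite /skew; case: ifP; rewrite !mxE mul0r ?mulr0 ?subr0.
have [|||cs [[csX ucs tcs scs] pcs]] := @occupied_path t G G 0 0 (leqnn G).
- by rewrite sk0 subnn mulr0 mul0r.
- by move=> i ii0; rewrite sk0 normr0 mulr_ge0// ltW.
- by move=> b _; rewrite subr0; apply: plength_le_pnorm => //; exact: pp_locally_finite PP t.
have -> : \sum_(g < G) \1_(occupied g) t = (size cs)%:R :> R.
  rewrite scs subnn -(big_mkord xpredT (fun g => \1_(occupied g) t : R)).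
  by rewrite /index_iota subn0.
move: pcs; rewrite !subr0 linfZ (ad_f AD) mulr1 => pcs.
apply: le_trans pcs; apply: ge_inf.
  exists 0 => _ [pi _ <-]; apply: sumr_ge0 => e _; exact: plength_ge0.
exists cs => //; split => //.
  by rewrite /= ucs andbT; apply/negP => /tcs; rewrite sk0 ltxx.
rewrite rcons_uniq ucs andbT; apply/negP => /tcs; by rewrite ltxx andbF.
Qed.

End upper_bound.

(** * Consequences of the convergence in mean *)

Section time_constant.
Context (R : realType) (d : nat) (disp : measure_display)
  (T : measurableType disp) (P : probability T R) (Xi : T -> set 'rV[R]_d)
  (p : \bar R) (eps : R) (z : 'rV[R]_d) (mu : R).
Hypothesis TC : is_time_constant P Xi p eps z mu.
Local Notation F := (fun (s : R) (t : T) => travel_time p eps (Xi t) 0 (s *: z) / s).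

Lemma time_constant_L1 (e : R) : 0 < e -> exists M, forall s, M < s ->
  (\int[P]_t (`|F s t - mu|)%:E < e%:E)%E.
Proof.
move=> e0; have := tc_L1 TC; move=> /(_ [set y | (y < e%:E)%E]).
case; last by move=> M [_ HM]; exists M => s /HM.
apply: open_nbhs_nbhs; split; first exact: open_ereal_lt_ereal.
by rewrite /= lte_fin.
Qed.

Lemma measurable_time s : 0 < s -> measurable_fun setT (F s).
Proof.
move=> s0; apply: measurable_funM => //.
by have := measurable_int _ (tc_integrable TC s0); move/measurable_EFinP.
Qed.

Lemma measurable_time_dist s : 0 < s ->
  measurable_fun setT (fun t => (`|F s t - mu|)%:E).
Proof.
move=> s0; apply/measurable_EFinP; apply: measurableT_comp => //.
by apply: measurable_funB => //; exact: measurable_time.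
Qed.

(** If mu were less than m, the complement of A alone would contribute (m - mu) / 2
to the mean distance. *)
Lemma time_constant_ge (m M0 : R) :
  (forall s, M0 < s -> exists A, [/\ measurable A, (P A <= (2^-1)%:E)%E &
    forall t, ~ A t -> m <= F s t]) -> m <= mu.
Proof.
move=> H; rewrite leNgt; apply/negP => mum.
have e0 : 0 < (m - mu) / 2 by rewrite divr_gt0 ?subr_gt0.
have [M HM] := time_constant_L1 e0.
pose s := 1 + Num.max 0 (Num.max M M0).
have [s0 sM sM0] : [/\ 0 < s, M < s & M0 < s].
  have h1 : 0 <= Num.max 0 (Num.max M M0) by rewrite le_max lexx.
  have h2 : M <= Num.max 0 (Num.max M M0) by rewrite !le_max lexx orbT.
  have h3 : M0 <= Num.max 0 (Num.max M M0) by rewrite !le_max lexx !orbT.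
  by rewrite /s; split; lra.
have [A [mA PA HA]] := H s sM0.
have := HM s sM; apply/negP; rewrite -leNgt.
apply: (@le_trans _ _ (\int[P]_t ((m - mu)%:E * (\1_(~` A) t)%:E))%E).
  rewrite ge0_integralZl//; last 2 first.
  - by apply/measurable_EFinP; apply: measurable_indic; exact: measurableC.
  - by rewrite lee_fin subr_ge0 ltW.
  rewrite integral_indic//; last exact: measurableC.
  rewrite setIT [X in (_ <= _ * X)%E](_ : _ = (1 - P A)%E); last first.
    exact: probability_setC.
  have fA : P A \is a fin_num by exact: fin_num_measure.
  rewrite -(fineK fA) lee_fin in PA *; rewrite -EFinB -EFinM lee_fin.
  by apply: ler_wpM2l; [rewrite subr_ge0 ltW|lra].
apply: ge0_le_integral => //.
- by move=> t _; rewrite -EFinM lee_fin mulr_ge0// subr_ge0 ltW.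
- apply: measurable_funeM; apply/measurable_EFinP; apply: measurable_indic.
  exact: measurableC.
- exact: measurable_time_dist.
- move=> t _; rewrite -EFinM lee_fin indicE.
  have [At|At] := pselect (A t).
    by rewrite memNset ?mulr0//= => /(_ At).
  rewrite mem_set// mulr1; have := HA t At => h.
  by apply: le_trans (ler_norm _); rewrite lerB.
Qed.

Lemma integral_sum_indic (E : nat -> set T) (pi0 : R) G :
  (forall g, measurable (E g)) -> (forall g, P (E g) = pi0%:E) ->
  (\int[P]_t (\sum_(g < G) \1_(E g) t)%:E)%E = (G%:R * pi0)%:E.
Proof.
move=> mE PE; elim: G => [|G IH].
  by under eq_integral do rewrite big_ord0; rewrite integral0 mul0r.
under eq_integral do rewrite big_ord_recr/= EFinD.
rewrite ge0_integralD//.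
- rewrite IH integral_indic//.
  transitivity ((G%:R * pi0)%:E + P (E G))%E; first by rewrite setIT.
  by rewrite PE -EFinD -natr1 mulrDl mul1r.
- by move=> t _; rewrite lee_fin sumr_ge0.
- apply/measurable_EFinP; apply: measurable_sum => g.
  by apply: measurable_indic; exact: mE.
- by apply/measurable_EFinP; apply: measurable_indic; exact: mE.
Qed.

Lemma time_constant_le_mean (E : nat -> set T) (pi0 r q s : R) G :
  (forall g, measurable (E g)) -> (forall g, P (E g) = pi0%:E) ->
  0 < s -> 0 <= q -> 0 <= r ->
  (forall t, F s t <= r - q * \sum_(g < G) \1_(E g) t) ->
  ((q * (G%:R * pi0) + mu)%:E <= \int[P]_t (`|F s t - mu|)%:E + r%:E)%E.
Proof.
move=> mE PE s0 q0 r0 H.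
have mS : measurable_fun setT (fun t => (\sum_(g < G) \1_(E g) t : R)%:E).
  by apply/measurable_EFinP; apply: measurable_sum => g; apply: measurable_indic; exact: mE.
have cst0 (k : R) : (\int[P]_t k%:E = k%:E)%E.
  by rewrite integral_cst// [X in (_ * X)%E]probability_setT mule1.
(* Adding |mu| to both sides makes the integrands nonnegative. *)
have mu0 : 0 <= mu + `|mu| by have := ler_norm (- mu); rewrite normrN; lra.
have H1 : ((q * (G%:R * pi0))%:E + (mu + `|mu|)%:E <=
     \int[P]_t (`|F s t - mu|)%:E + (r + `|mu|)%:E)%E.
  rewrite -(cst0 (mu + `|mu|)) -(cst0 (r + `|mu|)) EFinM.
  rewrite -(integral_sum_indic G mE PE) -ge0_integralZl//; last first.
    by move=> t _; rewrite lee_fin sumr_ge0.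
  rewrite -!ge0_integralD//; last 4 first.
  - exact: measurable_time_dist.
  - by move=> t _; rewrite lee_fin addr_ge0.
  - by move=> t _; rewrite -EFinM lee_fin mulr_ge0// sumr_ge0.
  - exact: measurable_funeM.
  apply: ge0_le_integral => //.
  - by move=> t _; rewrite -EFinM -EFinD lee_fin addr_ge0// mulr_ge0// sumr_ge0.
  - by apply: emeasurable_funD => //; exact: measurable_funeM.
  - by apply: emeasurable_funD => //; exact: measurable_time_dist.
  - move=> t _; rewrite -EFinM -!EFinD lee_fin.
    by have := H t; have := ler_norm (mu - F s t); rewrite distrC; lra.
move: H1; rewrite -EFinD.
case: (\int[P]_t (`|F s t - mu|)%:E)%E => [y||]//.
  by rewrite -!EFinD !lee_fin; lra.
by move=> _; rewrite addye// leey.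
Qed.

End time_constant.

(** This is where the exponent comes from: a box of slope x has volume
delta ^+ d * x `^ (- \sum_i beta i). *)
Lemma prod_widths (R : realType) (d : nat) (i0 : 'I_d) (beta : 'I_d -> R)
    (delta x : R) : 0 < delta -> 0 < x -> beta i0 = 1 ->
  delta / x * \prod_(i | i != i0) (delta * x `^ (- beta i)) =
  delta ^+ d * x `^ (- \sum_i beta i).
Proof.
move=> delta0 x0 b0.
have -> : delta / x = delta * x `^ (- beta i0) by rewrite b0 powR_inv1// ltW.
transitivity (\prod_i (delta * x `^ (- beta i))); first by rewrite [RHS](bigD1 i0).
rewrite big_split/= prodr_const card_ord; congr (_ * _).
rewrite -sumrN; elim/big_rec2: _ => [|i y1 y2 _ ->]; first by rewrite powRr0.
by rewrite powRD ?(gt_eqF x0) ?implybT.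
Qed.

Lemma exists_slab_count (R : realType) (d : nat) (u : 'rV[R]_d) (L : R)
    (w : 'I_d -> R) : 0 < L -> (forall i, 0 < w i) ->
  exists2 n, (0 < n)%N & forall i, `|u 0 i| * (L / n%:R) <= w i.
Proof.
move=> L0 w0; pose B := \sum_i `|u 0 i| * L / w i.
have t0 i : 0 <= `|u 0 i| * L / w i.
  by rewrite divr_ge0 ?(ltW (w0 i))// mulr_ge0// ltW.
have B0 : 0 <= B by exact: sumr_ge0.
exists (Num.bound B).+1 => // i.
have Bn : B <= (Num.bound B).+1%:R.
  by rewrite -natr1; have := archi_boundP B0; lra.
rewrite mulrA ler_pdivrMr ?ltr0n// [leRHS]mulrC -ler_pdivrMr//.
apply: le_trans Bn; rewrite /B (bigD1 i)//= lerDl.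
by apply: sumr_ge0 => j _; exact: t0.
Qed.

(** * Bounds on the time constant *)

Section bounds.
Context (R : realType) (d : nat) (disp : measure_display)
  (T : measurableType disp) (P : probability T R) (Xi : T -> set 'rV[R]_d)
  (p : \bar R) (u : 'rV[R]_d) (i0 : 'I_d) (beta : 'I_d -> R) (f : 'rV[R]_d)
  (c eps mu : R).
Hypotheses (d0 : (0 < d)%N) (p1 : (1 <= p)%E) (AD : adapted p u i0 beta f c)
  (PP : poisson_process P Xi) (eps0 : 0 < eps)
  (TC : is_time_constant P Xi p eps u mu).
Let b : R := \sum_i beta i.
Let y : R := eps `^ b^-1.
Let delta : R := eps `^ d%:R^-1.

Lemma sum_beta_ge1 : 1 <= b.
Proof.
rewrite /b (bigD1 i0)//= (ad_beta0 AD) lerDl; apply: sumr_ge0 => i _.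
exact: ad_beta AD i.
Qed.

Let b0 : 0 < b. Proof. exact: lt_le_trans sum_beta_ge1. Qed.
Let y0 : 0 < y. Proof. exact: powR_gt0. Qed.
Let delta0 : 0 < delta. Proof. exact: powR_gt0. Qed.
Let yb : y `^ b = eps.
Proof. by rewrite /y -powRrM mulVf ?gt_eqF// powRr1// ltW. Qed.
Let deltad : delta ^+ d = eps.
Proof.
have dn0 : d%:R != 0 :> R by rewrite pnatr_eq0 -lt0n.
rewrite /delta -powR_mulrn; last exact: powR_ge0.
rewrite -powRrM.
rewrite (mulVf dn0).
exact: powRr1 (ltW eps0).
Qed.

Lemma slabs_volume k x n : 0 < k -> 0 < x -> (0 < n)%N ->
  cell_volume u i0 (delta / (x * n%:R)) (fun i => k * (delta * x `^ (- beta i))) * n%:R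
  = `|u 0 i0| * \prod_(i < d | i != i0) k * (eps / x `^ b).
Proof.
move=> k0 x0 n0; have := prod_widths delta0 x0 (ad_beta0 AD).
rewrite -/b powRN deltad => <-.
rewrite /cell_volume big_split/=; field.
by rewrite !gt_eqF// ltr0n.
Qed.

(** Taking x = C y instead of y divides the volume of the boxes by at least C,
which brings the ratio of the series in [short_crowded_prob] below 1/2. *)
Lemma time_constant_lower (C x : R) :
  C = 1 + 2 * `|u 0 i0| * expR (4 * c * d%:R + 2) * hop_const d c ->
  x = C * y -> x <= 1 -> 1 - 2 * x <= mu.
Proof.
move=> CE xE x1; have h0 := hop_const_gt0 d (ad_c AD).
have e0 := expR_gt0 (4 * c * d%:R + 2).
have D0 : 0 <= `|u 0 i0| * expR (4 * c * d%:R + 2) * hop_const d c.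
  by apply: mulr_ge0; [apply: mulr_ge0|]; rewrite // ltW.
have C1 : 1 <= C by rewrite CE -!mulrA; move: D0; rewrite -!mulrA; lra.
have x0 : 0 < x by rewrite xE mulr_gt0//; lra.
have L0 : 0 < delta / x by rewrite divr_gt0.
have w0 i : 0 < delta * x `^ (- beta i) by rewrite mulr_gt0// powR_gt0.
have [n n0 nw] := exists_slab_count u L0 w0.
have etaE : delta / x / n%:R = delta / (x * n%:R) by rewrite invfM mulrA.
have small : cell_volume u i0 (delta / (x * n%:R)) (fun i => delta * x `^ (- beta i)) *
    expR (4 * c * d%:R + 2) * (hop_const d c * n%:R) <= 2^-1.
  have := slabs_volume ltr01 x0 n0.
  under [X in cell_volume _ _ _ X]funext do rewrite mul1r.
  rewrite big1// mulr1 => V.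
  have xb : eps / x `^ b <= C^-1.
    rewrite xE powRM ?(ltW y0)//; last by lra.
    rewrite yb invfM mulrCA mulfV ?gt_eqF// mulr1 lef_pV2 ?posrE ?powR_gt0//; try lra.
    exact: le1r_powR sum_beta_ge1.
  rewrite mulrAC (mulrC (hop_const d c)) mulrA V.
  apply: (@le_trans _ _ (`|u 0 i0| * C^-1 * hop_const d c * expR (4 * c * d%:R + 2))).
    rewrite ler_wpM2r ?(ltW e0)// ler_wpM2r ?(ltW h0)// ler_wpM2l//.
  have -> : `|u 0 i0| / C * hop_const d c * expR (4 * c * d%:R + 2) =
    `|u 0 i0| * expR (4 * c * d%:R + 2) * hop_const d c / C by ring.
  by rewrite ler_pdivrMr; lra.
(* Beyond this length 2 - s x / delta < -3, and 2 exp (-3) is less than 1/2. *)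
apply: (time_constant_ge TC (M0 := 5 * delta / x)) => s s5.
have s0 : 0 < s by apply: lt_trans s5; rewrite divr_gt0 ?mulr_gt0.
have [|A [mA PA HA]] := travel_time_lower p1 AD PP eps0 x0 x1 n0 _ small s0.
  by move=> i _; rewrite -/delta -etaE.
exists A; split => //.
  apply: le_trans PA _; rewrite lee_fin -/delta.
  have S5 : 5 < s * x / delta by rewrite ltr_pdivlMr// mulrC -ltr_pdivrMr// mulrC.
  have e3 : expR (2 - s * x / delta) <= expR (- 3) :> R by rewrite ler_expR; lra.
  have e4 := expR_ge1Dx (3 : R); have e5 := expRxMexpNx_1 (3 : R).
  have := expR_gt0 (- 3 : R); have := expR_gt0 (3 : R); nra.
by move=> t At; rewrite ler_pdivlMr// mulrC; exact: HA.
Qed.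

(** The boxes of slope y have volume V for all eps. A proportion 1 - exp (- V) of
the boxes is occupied, there is one box per length 2 L, and each occupied one
saves delta / 4. *)
Lemma time_constant_upper (V : R) :
  V = `|u 0 i0| * \prod_(i < d | i != i0) (c / 4) ->
  y <= 1 -> y <= `|u 0 i0| ->
  mu <= 1 - (1 - expR (- V)) / 8 * y.
Proof.
have arith (a1 a2 a3 e m : R) : a3 - a1 + m < e / 2 + (1 + a2) ->
    a2 + a1 < e / 2 -> e = m - 1 + a3 -> False.
  move=> h1 h2 h3.
  have : e < e; last by rewrite ltxx.
  by lra.
move=> VE y1 yu; have c0 := ad_c AD; have c4 : 0 < c / 4 by rewrite divr_gt0.
have V0 : 0 < V.
  by rewrite VE mulr_gt0 ?normr_gt0 ?(ad_u AD)//; apply: prodr_gt0.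
pose pi0 := 1 - expR (- V).
have pi00 : 0 < pi0 by rewrite subr_gt0 expR_lt1 oppr_lt0.
have L0 : 0 < delta / y by rewrite divr_gt0.
have w0 i : 0 < c / 4 * (delta * y `^ (- beta i)).
  by rewrite mulr_gt0// mulr_gt0// powR_gt0.
have [n n0 nw] := exists_slab_count u L0 w0.
have etaE : delta / y / n%:R = delta / (y * n%:R) by rewrite invfM mulrA.
have etaw i : i != i0 -> `|u 0 i| * (delta / (y * n%:R)) <= c / 4 * (delta * y `^ (- beta i)).
  by move=> _; rewrite -etaE.
have := slabs_volume c4 y0 n0; rewrite yb divff ?gt_eqF// mulr1 -VE mulrC => nV.
have OP g := occupied_prob AD PP eps0 y0 n0 g.
have PE g : P (occupied Xi u i0 beta c eps y n g) = pi0%:E.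
  by rewrite (OP g).2 -/delta nV.
rewrite leNgt; apply/negP => big.
set m := 1 - _ in big; pose e := mu - m.
have e0 : 0 < e by rewrite subr_gt0.
have e20 : 0 < e / 2 by rewrite divr_gt0.
have [M HM] := time_constant_L1 TC e20.
(* K / N collects the boundary terms, which vanish for many boxes. *)
pose K := y / 4 + y * pi0 / 8.
have K0 : 0 < K by rewrite addr_gt0// divr_gt0// mulr_gt0.
pose G := Num.bound (2 * K / e + `|M| / (delta / y)).
have GB : 2 * K / e + `|M| / (delta / y) < G%:R.
  apply: archi_boundP; apply: addr_ge0; rewrite divr_ge0//.
  - by rewrite mulr_ge0// ltW.
  - exact: ltW.
  - exact: ltW.
have A1 : 0 <= 2 * K / e by rewrite divr_ge0 ?mulr_ge0 ?(ltW e0)// ltW.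
have A2 : 0 <= `|M| / (delta / y) by rewrite divr_ge0// ltW.
pose N : R := (2 * G).+1%:R.
have NE : N = 2 * G%:R + 1 by rewrite /N -natr1 natrM.
have N0 : 0 < N by rewrite NE; lra.
pose s := N * (delta / y).
have s0 : 0 < s by rewrite mulr_gt0.
have sM : M < s.
  apply: le_lt_trans (ler_norm M) _; rewrite -ltr_pdivrMr//.
  by rewrite NE; lra.
have := time_constant_le_mean TC (r := 1 + delta / 4 / s) (q := delta / 4 / s)
  (G := G) (fun g => (OP g).1) PE s0.
have q0 : 0 <= delta / 4 / s by rewrite !divr_ge0// ltW.
move=> /(_ q0 (addr_ge0 ler01 q0)) H.
have {}H : (((delta / 4 / s) * (G%:R * pi0) + mu)%:E <=
    \int[P]_t (`|travel_time p eps (Xi t) 0 (s *: u) / s - mu|)%:E + (1 + delta / 4 / s)%:E)%E.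
  apply: H => t; rewrite ler_pdivrMr//.
  have := travel_time_upper p1 AD PP eps0 y0 y1 yu n0 etaw t (erefl s : s = _).
  move/le_trans; apply; rewrite -/delta le_eqVlt; apply/orP; left; apply/eqP.
  by field; rewrite gt_eqF.
have := le_lt_trans H (lte_leD _ (HM s sM) (lexx _)).
rewrite -EFinD lte_fin => /(_ isT).
have -> : delta / 4 / s = y / 4 / N.
  by rewrite /s; field; rewrite !gt_eqF.
have -> : G%:R = (N - 1) / 2 by rewrite NE; field.
have KN : K / N < e / 2.
  rewrite ltr_pdivrMr// -ltr_pdivrMl//.
  have -> : (e / 2)^-1 * K = 2 * K / e by field; rewrite gt_eqF.
  by rewrite NE; lra.
have -> : y / 4 / N * ((N - 1) / 2 * pi0) = y * pi0 / 8 - y * pi0 / 8 / N.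
  by field; rewrite gt_eqF.
have KE : K / N = y / 4 / N + y * pi0 / 8 / N by rewrite /K mulrDl.
have eE : e = mu - 1 + y * pi0 / 8 by rewrite /e /m /pi0; ring.
rewrite KE in KN => h.
exact: arith h KN eE.
Qed.

End bounds.

Theorem theorem1 (R : realType) (d : nat) (hd : (2 <= d)%N)
    (p : \bar R) (hp : (1 <= p)%E) (u : 'rV[R]_d) (hu : pnorm p u = 1) :
  exists C1 C2 : R, [/\ 0 < C1, 0 < C2 &
    \forall eps \near 0^'+,
      forall (disp : measure_display) (T : measurableType disp)
        (P : probability T R) (Xi : T -> set 'rV[R]_d) (mu : R),
        poisson_process P Xi ->
        is_time_constant P Xi p eps u mu ->
        C1 * eps `^ kappa p u <= 1 - mu <= C2 * eps `^ kappa p u].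
Proof.
have [i0 [beta [f [c [AD kE]]]]] := exists_adapted hp hu.
have c0 := ad_c AD; have ui0 := ad_u AD.
pose V := `|u 0 i0| * \prod_(i < d | i != i0) (c / 4).
pose C := 1 + 2 * `|u 0 i0| * expR (4 * c * d%:R + 2) * hop_const d c.
have V0 : 0 < V.
  by rewrite mulr_gt0 ?normr_gt0//; apply: prodr_gt0 => i _; rewrite divr_gt0.
have C1 : 1 <= C.
  rewrite lerDl; apply: mulr_ge0; last exact/ltW/hop_const_gt0.
  by rewrite mulr_ge0 ?expR_ge0// mulr_ge0.
have k0 : 0 < kappa p u.
  by rewrite kE invr_gt0; apply: lt_le_trans (sum_beta_ge1 AD).
exists ((1 - expR (- V)) / 8), (2 * C); split.
- by rewrite divr_gt0// subr_gt0 expR_lt1 oppr_lt0.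
- by rewrite mulr_gt0//; lra.
have xi0 : 0 < Num.min C^-1 `|u 0 i0|.
  by rewrite lt_min normr_gt0 ui0 invr_gt0 andbT; lra.
near=> eps => disp T P Xi mu PP TC.
have eps0 : 0 < eps by near: eps; exact: nbhs_right_gt.
have : eps `^ kappa p u < Num.min C^-1 `|u 0 i0|.
  by near: eps; exact: (cvgr_lt _ (powR_cvg0 k0)).
rewrite lt_min => /andP[yC yu].
have Cy : C * eps `^ kappa p u <= 1.
  by rewrite -ler_pdivlMl ?mulr1 ?ltW//; lra.
have y0 : 0 < eps `^ kappa p u by exact: powR_gt0.
have y1 : eps `^ kappa p u <= 1 by nra.
have d0 : (0 < d)%N by exact: ltnW.
rewrite kE in yu Cy y0 y1 *; apply/andP; split.
  by have := time_constant_upper d0 hp AD PP eps0 TC (erefl V) y1 (ltW yu); lra.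
by have := time_constant_lower d0 hp AD PP eps0 TC (erefl C) erefl Cy; lra.
Unshelve. all: by end_near. Qed.
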